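(* $\mathrm{ZL}^1(\mathrm{SU}(2))$ is not amenable.
   Context: $\mathrm{ZL}^1(G)$ denotes the centre of the convolution algebra $\mathrm{L}^1(G)$ of a compact group $G$ (normalised Haar measure). A Banach algebra $\mathfrak{A}$ is amenable if it has a bounded approximate diagonal: a bounded net $(\mu_\alpha)$ in $\mathfrak{A}\hat\otimes\mathfrak{A}$ with $m(\mu_\alpha)a\to a$, $a\,m(\mu_\alpha)\to a$, $a\cdot\mu_\alpha-\mu_\alpha\cdot a\to0$ for all $a$ ($m$ multiplication, $a\cdot(b\otimes c)=ab\otimes c$, $(b\otimes c)\cdot a=b\otimes ca$). *)

(* Defs.v *)
From HB Require Import structures.
From mathcomp Require Import all_boot all_order all_algebra.
From mathcomp Require Import all_classical all_reals all_analysis.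
From mathcomp.real_closed Require Import complex.

Set Implicit Arguments.
Unset Strict Implicit.
Unset Printing Implicit Defensive.

Import Order.TTheory GRing.Theory Num.Theory.
Import numFieldNormedType.Exports.
Local Open Scope classical_set_scope.
Local Open Scope ring_scope.

Section SU2.
Variable R : realType.

(** ** The group SU(2).
    An element of SU(2) is a matrix  [[ α, -conj β ], [ β, conj α ]]  with
    |α|^2 + |β|^2 = 1; we record it by the pair (α, β) ∈ C × C, and write
    α = a + i b, β = c + i d.  The carrier is R^4 = (R*R)*(R*R) with its
    (product = Borel) sigma-algebra; SU(2) is the unit sphere inside it. *)
Definition SU2car : Type := ((R * R) * (R * R))%type.

Definition alpha (x : SU2car) : complex R := Complex x.1.1 x.1.2.
Definition beta (x : SU2car) : complex R := Complex x.2.1 x.2.2.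
Definition re (z : complex R) : R := let: Complex a _ := z in a.
Definition im (z : complex R) : R := let: Complex _ b := z in b.

Definition of_ab (a b : complex R) : SU2car :=
  ((re a, im a), (re b, im b)).

Definition cconj (z : complex R) : complex R := Complex (re z) (- im z).

Definition SU2 : set SU2car :=
  [set x | x.1.1 ^+ 2 + x.1.2 ^+ 2 + x.2.1 ^+ 2 + x.2.2 ^+ 2 = 1].

(** Matrix product:
  [[a1, -b1*],[b1, a1*]] [[a2, -b2*],[b2, a2*]]
   = [[a1 a2 - b1* b2, ...],[b1 a2 + a1* b2, ...]]. *)
Definition mulG (x y : SU2car) : SU2car :=
  of_ab (alpha x * alpha y - cconj (beta x) * beta y)
        (beta x * alpha y + cconj (alpha x) * beta y).

(** Inverse (= adjoint) of [[a, -b*],[b, a*]] is [[a*, b*],[-b, a]]. *)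
Definition invG (x : SU2car) : SU2car := of_ab (cconj (alpha x)) (- beta x).

(** Haar measure: a (normalised) probability measure on R^4 carried by SU(2)
    and invariant under left translations by elements of SU(2).  (The Haar
    probability measure of the compact group SU(2) is the unique such measure.) *)
Definition is_haar (mu : probability SU2car R) : Prop :=
  mu SU2 = 1%E /\
  forall g, SU2 g -> forall A, measurable A ->
    mu ((fun x => mulG g x) @^-1` A) = mu A.

Variable mu : probability SU2car R.

Definition cabs (z : complex R) : R := Num.sqrt (re z ^+ 2 + im z ^+ 2).

Definition L1 (f : SU2car -> complex R) : Prop :=
  mu.-integrable setT (fun x => (re (f x))%:E) /\
  mu.-integrable setT (fun x => (im (f x))%:E).

Definition cint (f : SU2car -> complex R) : complex R :=
  Complex (Rintegral mu setT (fun x => re (f x)))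
          (Rintegral mu setT (fun x => im (f x))).

Definition nrm1 (f : SU2car -> complex R) : R :=
  Rintegral mu setT (fun x => cabs (f x)).

Definition conv (f g : SU2car -> complex R) : SU2car -> complex R :=
  fun x => cint (fun y => f y * g (mulG (invG y) x)).

(** Elements of the centre ZL^1(SU(2)) of the convolution algebra L^1(SU(2))
    (elements of L^1 are functions up to mu-a.e. equality). *)
Definition ZL1 (f : SU2car -> complex R) : Prop :=
  L1 f /\ forall g, L1 g ->
    {ae mu, forall x, conv f g x = conv g f x}.

(** ** The projective tensor product ZL^1 \hat\otimes ZL^1.
    An element is represented by a series  \sum_i a_i (x) b_i  with
    a_i, b_i in ZL^1 and \sum_i ||a_i|| ||b_i|| < oo. *)
Definition tensor := nat -> ((SU2car -> complex R) * (SU2car -> complex R)).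

Definition valid_tensor (u : tensor) : Prop :=
  (forall i, ZL1 (u i).1 /\ ZL1 (u i).2) /\
  cvgn (@series R (fun i => nrm1 (u i).1 * nrm1 (u i).2) : nat -> R).

Definition csum (v : nat -> complex R) : complex R :=
  Complex (limn (@series R (fun i => re (v i)) : nat -> R))
          (limn (@series R (fun i => im (v i)) : nat -> R)).

(** Bounded bilinear forms of norm <= 1 on ZL^1 x ZL^1, i.e. the unit ball of
    the dual (ZL^1 \hat\otimes ZL^1)^*. *)
Definition bilin_form1 (phi : (SU2car -> complex R) -> (SU2car -> complex R) -> complex R) :
  Prop :=
  (forall a a' b, ZL1 a -> ZL1 a' -> ZL1 b ->
     phi (fun x => a x + a' x) b = phi a b + phi a' b) /\
  (forall a b b', ZL1 a -> ZL1 b -> ZL1 b' ->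
     phi a (fun x => b x + b' x) = phi a b + phi a b') /\
  (forall k a b, ZL1 a -> ZL1 b ->
     phi (fun x => k * a x) b = k * phi a b /\
     phi a (fun x => k * b x) = k * phi a b) /\
  (forall a b, ZL1 a -> ZL1 b -> cabs (phi a b) <= nrm1 a * nrm1 b).

Definition pairing phi (u : tensor) : complex R :=
  csum (fun i => phi (u i).1 (u i).2).

(** Projective norm of the difference of the elements represented by u and v
    (computed by duality: ||w||_pi = sup over the dual unit ball). *)
Definition tdist (u v : tensor) : R :=
  sup [set r | exists phi, bilin_form1 phi /\
                 r = cabs (pairing phi u - pairing phi v)].

Definition tzero : tensor := fun _ => (fun _ => 0, fun _ => 0).

Definition tnorm (u : tensor) : R := tdist u tzero.

Definition lact (a : SU2car -> complex R) (u : tensor) : tensor :=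
  fun i => (conv a (u i).1, (u i).2).
Definition ract (u : tensor) (a : SU2car -> complex R) : tensor :=
  fun i => ((u i).1, conv (u i).2 a).

Definition mpart (u : tensor) (n : nat) : SU2car -> complex R :=
  fun x => \sum_(i < n) conv (u i).1 (u i).2 x.

(** ||m(u) a - a||_1  and  ||a m(u) - a||_1. *)
Definition m_left_err (u : tensor) (a : SU2car -> complex R) : R :=
  limn (fun n => nrm1 (fun x => conv (mpart u n) a x - a x)).
Definition m_right_err (u : tensor) (a : SU2car -> complex R) : R :=
  limn (fun n => nrm1 (fun x => conv a (mpart u n) x - a x)).

Definition directed_set (I : Type) (le : I -> I -> Prop) : Prop :=
  (exists i : I, True) /\
  (forall i, le i i) /\
  (forall i j k, le i j -> le j k -> le i k) /\
  (forall i j, exists k, le i k /\ le j k).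

Definition net_to0 (I : Type) (le : I -> I -> Prop) (r : I -> R) : Prop :=
  forall eps : R, 0 < eps -> exists i0, forall i, le i0 i -> `|r i| < eps.

(** ZL^1(SU(2)) has a bounded approximate diagonal. *)
Definition ZL1_amenable : Prop :=
  exists (I : Type) (le : I -> I -> Prop) (net : I -> tensor),
    directed_set le /\
    (forall i, valid_tensor (net i)) /\
    (exists K : R, forall i, tnorm (net i) <= K) /\
    (forall a, ZL1 a ->
       net_to0 le (fun i => m_left_err (net i) a) /\
       net_to0 le (fun i => m_right_err (net i) a) /\
       net_to0 le (fun i => tdist (lact a (net i)) (ract (net i) a))).

End SU2.

(* Main.v *)
(** Let [r] be half the trace on SU(2), so that [r = cos t] on the matrices with
    eigenvalues [exp (± i t)].  The characters of ZL^1 are [omega n f = ∫ f alpha^n]: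
    a central [f] has conjugation-invariant integrals, and invariance under the
    diagonal torus kills every mixed term in the binomial expansion of
    [alpha (y z) ^ n].  Along a bounded approximate diagonal the numbers obtained by
    applying [omega m ⊗ omega n] converge to 1 if [m = n] and to 0 otherwise.
    On the other hand [f ↦ ∫ f T_n(r)], with [T_n] the Chebyshev polynomial, has norm
    at most 1, while infinitesimal rotation invariance gives
    [2 ∫ f T_(n+2)(r) = (n+3) omega (n+2) f - (n+1) omega n f] for central [f].  The
    tensor square of this functional thus tends to [((n+3)^2 + (n+1)^2) / 4] along the
    approximate diagonal, for every [n], which contradicts boundedness. *)

Require Import Defs.
From HB Require Import structures.
From mathcomp Require Import all_boot all_order all_algebra.
From mathcomp Require Import all_classical all_reals all_analysis.
From mathcomp.real_closed Require Import complex.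
From mathcomp Require Import measurable_realfun.
From mathcomp Require Import ring lra.

Set Implicit Arguments.
Unset Strict Implicit.
Unset Printing Implicit Defensive.

Import Order.TTheory GRing.Theory Num.Theory.
Import numFieldNormedType.Exports.
Local Open Scope classical_set_scope.
Local Open Scope ring_scope.

(* MathComp-Analysis also exports a [conv] (convex combination). *)
Local Notation conv := Defs.conv.

(** * Complex numbers and quaternions *)
Section ComplexNumbers.
Variable R : realType.
Implicit Types z w : complex R.

(** [alpha ^ n] is the highest weight matrix coefficient of the irreducible representation of
    dimension n + 1; averaged over conjugations it becomes the normalised character U_n(r) / (n +
    1), with U_n the Chebyshev polynomial of the second kind. The factors n + 3 and n + 1 come from
    2 T_(n+2) = U_(n+2) - U_n: the kernel T_(n+2) stays bounded by 1 while its coefficients on the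
    normalised characters grow with n. Haar measure is accessible only through its invariance, so
    U_n is linked to [alpha ^ n] by differentiating [alpha ^ n.+1 * beta] along conjugations instead
    of using Weyl's integration formula. Centrality is an almost everywhere statement for each test
    function separately; polynomial kernels, spanned by countably many monomials, upgrade it to
    every group element. Powers of r separate the characters: omega n kills r ^ m for m < n but not
    r ^ n. *)

Lemma complex_ext z w : re z = re w -> im z = im w -> z = w.
Proof. by case: z w => [a b] [c d] /= -> ->. Qed.

Lemma reD z w : re (z + w) = re z + re w. Proof. by case: z w => [a b] []. Qed.
Lemma imD z w : im (z + w) = im z + im w. Proof. by case: z w => [a b] []. Qed.
Lemma reN z : re (- z) = - re z. Proof. by case: z. Qed.
Lemma imN z : im (- z) = - im z. Proof. by case: z. Qed.
Lemma reM z w : re (z * w) = re z * re w - im z * im w.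
Proof. by case: z w => [a b] []. Qed.
Lemma imM z w : im (z * w) = re z * im w + im z * re w.
Proof. by case: z w => [a b] []. Qed.

Lemma re_sum n (F : nat -> complex R) :
  re (\sum_(0 <= i < n) F i) = \sum_(0 <= i < n) re (F i).
Proof. by elim: n => [|n IH]; rewrite ?big_nil// !big_nat_recr//= reD IH. Qed.
Lemma im_sum n (F : nat -> complex R) :
  im (\sum_(0 <= i < n) F i) = \sum_(0 <= i < n) im (F i).
Proof. by elim: n => [|n IH]; rewrite ?big_nil// !big_nat_recr//= imD IH. Qed.

Lemma norm_cabs z : `|z| = (cabs z)%:C%C.
Proof. by case: z. Qed.

Lemma cabs_ge0 z : 0 <= cabs z. Proof. exact: sqrtr_ge0. Qed.
Lemma cabs0 : cabs (0 : complex R) = 0.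
Proof. by rewrite /cabs/= expr0n/= addr0 sqrtr0. Qed.
Lemma cabs1 : cabs (1 : complex R) = 1.
Proof. by rewrite /cabs/= expr0n/= expr1n addr0 sqrtr1. Qed.
Lemma cabsN z : cabs (- z) = cabs z.
Proof. by rewrite /cabs reN imN !sqrrN. Qed.
Lemma cabsM z w : cabs (z * w) = cabs z * cabs w.
Proof.
by apply: (@complexI R); rewrite -norm_cabs normrM !norm_cabs -rmorphM.
Qed.
Lemma cabsX z n : cabs (z ^+ n) = cabs z ^+ n.
Proof. by elim: n => [|n IH]; rewrite ?expr0 ?cabs1// !exprS cabsM IH. Qed.
Lemma cabsD z w : cabs (z + w) <= cabs z + cabs w.
Proof. by rewrite -lecR rmorphD /= -!norm_cabs ler_normD. Qed.
Lemma cabsB z w : cabs (z - w) <= cabs z + cabs w.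
Proof. by rewrite -(cabsN w) cabsD. Qed.
Lemma cabs_eq0 z : cabs z = 0 -> z = 0.
Proof.
by move=> z0; apply/eqP; rewrite -normr_eq0 norm_cabs z0.
Qed.
Lemma cabs_sq z : cabs z ^+ 2 = re z ^+ 2 + im z ^+ 2.
Proof. by rewrite sqr_sqrtr// addr_ge0// sqr_ge0. Qed.
Lemma re_le_cabs z : `|re z| <= cabs z.
Proof. by rewrite -sqrtr_sqr ler_wsqrtr// lerDl sqr_ge0. Qed.
Lemma im_le_cabs z : `|im z| <= cabs z.
Proof. by rewrite -sqrtr_sqr ler_wsqrtr// lerDr sqr_ge0. Qed.
Lemma cabs_le z : cabs z <= `|re z| + `|im z|.
Proof.
rewrite -[leRHS]ger0_norm ?addr_ge0// -sqrtr_sqr ler_wsqrtr// sqrrD !real_normK ?num_real//.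
by rewrite -addrA addrCA lerDr mulrn_wge0// mulr_ge0.
Qed.

Lemma cabs_real (a : R) : cabs (Complex a 0) = `|a|.
Proof. by rewrite /cabs/= expr0n/= addr0 sqrtr_sqr. Qed.

Lemma cabs_nat n : cabs (n%:R : complex R) = n%:R.
Proof.
have -> : (n%:R : complex R) = (n%:R : R)%:C%C by rewrite rmorph_nat.
by rewrite cabs_real normr_nat.
Qed.

Lemma cconj_mul z w : cconj (z * w) = cconj z * cconj w.
Proof. by apply: complex_ext; rewrite ?reM ?imM/= ?reM ?imM; ring. Qed.
Lemma cabs_cconj z : cabs (cconj z) = cabs z.
Proof. by rewrite /cabs/= sqrrN. Qed.
Lemma mul_cconj z : z * cconj z = (cabs z ^+ 2)%:C%C.
Proof. by apply: complex_ext; rewrite ?reM ?imM/= ?cabs_sq; ring. Qed.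

(** An n-th root of -1 does it. This supplies the torus elements on which a weight of degree [n] is
    nontrivial. *)
Lemma exists_unit_expr_neq1 n : (0 < n)%N ->
  exists2 t : complex R, cabs t = 1 & t ^+ n <> 1.
Proof.
move=> n0; exists (n.-root (-1 : complex R))%C.
  have : cabs (n.-root (-1 : complex R))%C ^+ n = 1.
    by rewrite -cabsX rootCK// cabsN cabs1.
  by move/eqP; rewrite pexpr_eq1 ?cabs_ge0// => /eqP.
rewrite rootCK// => /eqP; rewrite -subr_eq0 -opprD oppr_eq0.
by rewrite -[1]/(1%:R) -natrD pnatr_eq0.
Qed.

End ComplexNumbers.

Section Quaternions.
Variable R : realType.
Implicit Types x y z : SU2car R.

Definition oneG : SU2car R := ((1, 0), (0, 0)).

Lemma SU2car_ext x y :
  x.1.1 = y.1.1 -> x.1.2 = y.1.2 -> x.2.1 = y.2.1 -> x.2.2 = y.2.2 -> x = y.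
Proof. by case: x y => [[a b] [c d]] [[a' b'] [c' d']] /= -> -> -> ->. Qed.

Ltac qring := apply: SU2car_ext; rewrite /mulG /invG /of_ab ?reD ?imD ?reN ?imN ?reM ?imM /=; ring.

Lemma mulGA x y z : mulG x (mulG y z) = mulG (mulG x y) z.
Proof. by case: x y z => [[? ?] [? ?]] [[? ?] [? ?]] [[? ?] [? ?]]; qring. Qed.
Lemma mulG1 x : mulG x oneG = x.
Proof. by case: x => [[? ?] [? ?]]; qring. Qed.
Lemma mul1G x : mulG oneG x = x.
Proof. by case: x => [[? ?] [? ?]]; qring. Qed.
Lemma invGK x : invG (invG x) = x.
Proof. by case: x => [[? ?] [? ?]]; qring. Qed.
Lemma invGM x y : invG (mulG x y) = mulG (invG y) (invG x).
Proof. by case: x y => [[? ?] [? ?]] [[? ?] [? ?]]; qring. Qed.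

Definition sqnorm x := x.1.1 ^+ 2 + x.1.2 ^+ 2 + x.2.1 ^+ 2 + x.2.2 ^+ 2.

Lemma sqnormM x y : sqnorm (mulG x y) = sqnorm x * sqnorm y.
Proof.
case: x y => [[? ?] [? ?]] [[? ?] [? ?]].
by rewrite /sqnorm /mulG /of_ab ?reD ?imD ?reN ?imN ?reM ?imM /=; ring.
Qed.
Lemma sqnormV x : sqnorm (invG x) = sqnorm x.
Proof. by case: x => [[? ?] [? ?]]; rewrite /sqnorm /=; ring. Qed.

Lemma SU2E x : SU2 x = (sqnorm x = 1). Proof. by []. Qed.
Lemma SU2M x y : SU2 x -> SU2 y -> SU2 (mulG x y).
Proof. by rewrite !SU2E sqnormM => -> ->; rewrite mulr1. Qed.
Lemma SU2V x : SU2 x -> SU2 (invG x).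
Proof. by rewrite !SU2E sqnormV. Qed.
Lemma SU2_1 : SU2 oneG.
Proof. by rewrite SU2E /sqnorm/=; ring. Qed.

Lemma mulGV x : SU2 x -> mulG x (invG x) = oneG.
Proof.
case: x => [[a b] [c d]]; rewrite /SU2 /= => e.
apply: SU2car_ext; rewrite /mulG /invG /of_ab ?reD ?imD ?reN ?imN ?reM ?imM /=;
  rewrite -?e; ring.
Qed.
Lemma mulVG x : SU2 x -> mulG (invG x) x = oneG.
Proof. by move=> /SU2V/mulGV; rewrite invGK. Qed.
Lemma mulKG x y : SU2 x -> mulG (invG x) (mulG x y) = y.
Proof. by move=> sx; rewrite mulGA mulVG// mul1G. Qed.
Lemma mulVKG x y : SU2 x -> mulG x (mulG (invG x) y) = y.
Proof. by move=> sx; rewrite mulGA mulGV// mul1G. Qed.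
Lemma mulGK x y : SU2 x -> mulG (mulG y x) (invG x) = y.
Proof. by move=> sx; rewrite -mulGA mulGV// mulG1. Qed.
Lemma mulGVK x y : SU2 x -> mulG (mulG y (invG x)) x = y.
Proof. by move=> sx; rewrite -mulGA mulVG// mulG1. Qed.

Lemma alphaM x y : alpha (mulG x y) = alpha x * alpha y - cconj (beta x) * beta y.
Proof. by rewrite /mulG; case: (_ - _) => a b; case: (_ + _). Qed.
Lemma betaM x y : beta (mulG x y) = beta x * alpha y + cconj (alpha x) * beta y.
Proof. by rewrite /mulG; case: (_ - _) => a b; case: (_ + _). Qed.
Lemma re_mulG_comm x y : (mulG x y).1.1 = (mulG y x).1.1.
Proof.
case: x y => [[? ?] [? ?]] [[? ?] [? ?]].
by rewrite /mulG /of_ab /= ?reD ?imD ?reN ?imN ?reM ?imM /=; ring.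
Qed.

Lemma SU2_sq x : SU2 x -> cabs (alpha x) ^+ 2 + cabs (beta x) ^+ 2 = 1.
Proof. by rewrite !cabs_sq /= addrA. Qed.
Lemma cabs_alpha x : SU2 x -> cabs (alpha x) <= 1.
Proof.
move=> /SU2_sq e; rewrite -(@ler_pXn2r _ 2) ?nnegrE ?cabs_ge0// expr1n -e.
by rewrite lerDl sqr_ge0.
Qed.
Lemma cabs_beta x : SU2 x -> cabs (beta x) <= 1.
Proof.
move=> /SU2_sq e; rewrite -(@ler_pXn2r _ 2) ?nnegrE ?cabs_ge0// expr1n -e.
by rewrite lerDr sqr_ge0.
Qed.

End Quaternions.

(** * Measurability of complex functions and of the group operations *)

Section ComplexMeasurability.
Context {R : realType} {d : measure_display} {T : measurableType d}.
Implicit Types f g : T -> complex R.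

Definition cmeas f :=
  measurable_fun setT (fun x => re (f x)) /\ measurable_fun setT (fun x => im (f x)).

Lemma cmeas_cst (c : complex R) : cmeas (fun=> c).
Proof. by split; exact: measurable_cst. Qed.
Lemma cmeasD f g : cmeas f -> cmeas g -> cmeas (fun x => f x + g x).
Proof.
move=> [rf jf] [rg jg]; split.
  by under eq_fun do rewrite reD; exact: measurable_funD.
by under eq_fun do rewrite imD; exact: measurable_funD.
Qed.
Lemma cmeasM f g : cmeas f -> cmeas g -> cmeas (fun x => f x * g x).
Proof.
move=> [rf jf] [rg jg]; split.
  by under eq_fun do rewrite reM; apply: measurable_funB; exact: measurable_funM.
by under eq_fun do rewrite imM; apply: measurable_funD; exact: measurable_funM.
Qed.
Lemma cmeasN f : cmeas f -> cmeas (fun x => - f x).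
Proof.
move=> mf; have := cmeasM (cmeas_cst (-1)) mf.
by under eq_fun do rewrite mulN1r.
Qed.
Lemma cmeasB f g : cmeas f -> cmeas g -> cmeas (fun x => f x - g x).
Proof. by move=> mf mg; exact: (cmeasD mf (cmeasN mg)). Qed.
Lemma measurable_cabs f : cmeas f -> measurable_fun setT (fun x => cabs (f x)).
Proof.
move=> [rf jf].
have ms : measurable_fun setT (Num.sqrt : R -> R).
  apply: continuous_measurable_fun => x; exact: sqrt_continuous.
by apply: (measurableT_comp ms); apply: measurable_funD; exact: measurable_funX.
Qed.

End ComplexMeasurability.

Lemma cmeas_comp {R : realType} {d d' : measure_display} {T : measurableType d}
    {T' : measurableType d'} (phi : T -> T') (f : T' -> complex R) :
  measurable_fun setT phi -> cmeas f -> cmeas (fun x => f (phi x)).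
Proof.
by move=> mphi [rf jf]; split;
  [exact: (measurableT_comp rf mphi)|exact: (measurableT_comp jf mphi)].
Qed.

Section GroupMeasurability.
Context {R : realType} {d : measure_display} {T : measurableType d}.
Local Notation X := (SU2car R).

Lemma measurable_to_SU2car (phi : T -> X) :
  measurable_fun setT (fun t => (phi t).1.1) ->
  measurable_fun setT (fun t => (phi t).1.2) ->
  measurable_fun setT (fun t => (phi t).2.1) ->
  measurable_fun setT (fun t => (phi t).2.2) -> measurable_fun setT phi.
Proof.
move=> a b c e.
have -> : phi = fun t => (((phi t).1.1, (phi t).1.2), ((phi t).2.1, (phi t).2.2)).
  by apply/funext => t; case: (phi t) => [[]] ? ? [].
by apply: measurable_fun_pair => //=; apply: measurable_fun_pair.
Qed.

Lemma measurable_coords (phi : T -> X) : measurable_fun setT phi ->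
  [/\ measurable_fun setT (fun t => (phi t).1.1),
  measurable_fun setT (fun t => (phi t).1.2),
  measurable_fun setT (fun t => (phi t).2.1) &
  measurable_fun setT (fun t => (phi t).2.2)].
Proof.
move=> m; split.
- exact: (measurableT_comp measurable_fst (measurableT_comp measurable_fst m)).
- exact: (measurableT_comp measurable_snd (measurableT_comp measurable_fst m)).
- exact: (measurableT_comp measurable_fst (measurableT_comp measurable_snd m)).
- exact: (measurableT_comp measurable_snd (measurableT_comp measurable_snd m)).
Qed.

Lemma measurable_alpha (phi : T -> X) :
  measurable_fun setT phi -> cmeas (fun t => alpha (phi t)).
Proof. by case/measurable_coords. Qed.
Lemma measurable_beta (phi : T -> X) :
  measurable_fun setT phi -> cmeas (fun t => beta (phi t)).
Proof. by case/measurable_coords. Qed.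
Lemma cmeas_cconj (f : T -> complex R) : cmeas f -> cmeas (fun t => cconj (f t)).
Proof.
by move=> [rf jf]; split => //=; apply: measurableT_comp.
Qed.
Lemma measurable_of_ab (f g : T -> complex R) : cmeas f -> cmeas g ->
  measurable_fun setT (fun t => of_ab (f t) (g t)).
Proof. by move=> [? ?] [? ?]; exact: measurable_to_SU2car. Qed.

Lemma measurable_mulG (phi psi : T -> X) :
  measurable_fun setT phi -> measurable_fun setT psi ->
  measurable_fun setT (fun t => mulG (phi t) (psi t)).
Proof.
move=> m1 m2.
have a1 := measurable_alpha m1; have a2 := measurable_alpha m2.
have b1 := measurable_beta m1; have b2 := measurable_beta m2.
apply: measurable_of_ab.
  by apply: cmeasB; apply: cmeasM => //; exact: cmeas_cconj.
by apply: cmeasD; apply: cmeasM => //; exact: cmeas_cconj.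
Qed.

Lemma measurable_invG (phi : T -> X) :
  measurable_fun setT phi -> measurable_fun setT (fun t => invG (phi t)).
Proof.
move=> m; apply: measurable_of_ab.
  exact/cmeas_cconj/measurable_alpha.
exact/cmeasN/measurable_beta.
Qed.

End GroupMeasurability.

(** * Integration against the Haar measure *)
Section Integral.
Context {R : realType} (mu : probability (SU2car R) R).
Hypothesis haar : is_haar mu.
Local Notation X := (SU2car R).
Implicit Types f g k : X -> complex R.

Lemma measurable_SU2 : measurable (@SU2 R).
Proof.
have [a b c e] := measurable_coords (@measurable_id _ X setT).
have m : measurable_fun setT (@sqnorm R).
  by apply: measurable_funD; [apply: measurable_funD; [apply: measurable_funD|]|];
    exact: measurable_funX.
have := m measurableT [set 1] (measurable_set1 _).
by rewrite setTI.
Qed.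

Lemma ae_SU2 : {ae mu, forall x, SU2 x}.
Proof.
exists (~` @SU2 R); split => //; first exact: measurableC measurable_SU2.
by rewrite probability_setC ?haar.1 ?subee//; exact: measurable_SU2.
Qed.

Lemma L1_cmeas f : L1 mu f -> cmeas f.
Proof.
by case=> /integrableP[/measurable_EFinP rf _] /integrableP[/measurable_EFinP jf _].
Qed.

Lemma L1_integrable_cabs f : L1 mu f -> mu.-integrable setT (fun x => (cabs (f x))%:E).
Proof.
move=> lf; have [rf jf] := lf.
apply: (@le_integrable _ _ _ mu setT measurableT _
  (fun x => (`|re (f x)| + `|im (f x)|)%:E)).
- by apply/measurable_EFinP; exact: measurable_cabs (L1_cmeas lf).
- move=> x _ /=; rewrite lee_fin ger0_norm ?cabs_ge0// ger0_norm ?cabs_le//.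
- under eq_fun do rewrite EFinD.
  by apply: integrableD => //; exact: integrable_norm.
Qed.

Lemma le_L1 f (h : X -> R) : cmeas f -> mu.-integrable setT (fun x => (h x)%:E) ->
  (forall x, SU2 x -> cabs (f x) <= h x) -> L1 mu f.
Proof.
move=> [rf jf] ih fh.
have aux (u : X -> R) : measurable_fun setT u ->
    (forall x, `|u x| <= cabs (f x)) -> mu.-integrable setT (fun x => (u x)%:E).
  move=> mu' uf; apply/integrableP; split; first exact/measurable_EFinP.
  have /integrableP[mh hoo] := ih.
  apply: le_lt_trans hoo.
  apply: ae_ge0_le_integral => //.
  - exact/measurableT_comp/measurable_EFinP.
  - exact: measurableT_comp.
  - have := ae_SU2; apply: filterS => x sx _ /=.
    rewrite lee_fin (le_trans (uf _))// (le_trans (fh _ sx))//; exact: ler_norm.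
split; apply: aux => // x; [exact: re_le_cabs|exact: im_le_cabs].
Qed.

(** The bound is asked only on SU(2), which carries the measure: polynomials are unbounded on the
    ambient R^4. *)
Definition bddSU2 k := cmeas k /\ exists C : R, forall x, SU2 x -> cabs (k x) <= C.

Lemma L1_bdd k : bddSU2 k -> L1 mu k.
Proof.
move=> [mk [C kC]]; apply: (le_L1 mk _ kC).
exact: finite_measure_integrable_cst.
Qed.

Lemma L1M f k : L1 mu f -> bddSU2 k -> L1 mu (fun x => f x * k x).
Proof.
move=> lf [mk [C kC]].
apply: (@le_L1 _ (fun x => C * cabs (f x))).
- exact: cmeasM (L1_cmeas lf) mk.
- under eq_fun do rewrite EFinM.
  by apply: integrableZl => //; exact: L1_integrable_cabs.
- by move=> x sx; rewrite cabsM mulrC ler_wpM2r ?cabs_ge0// kC.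
Qed.

Lemma L1D f g : L1 mu f -> L1 mu g -> L1 mu (fun x => f x + g x).
Proof.
move=> [rf jf] [rg jg]; split.
  by under eq_fun do rewrite reD EFinD; exact: integrableD.
by under eq_fun do rewrite imD EFinD; exact: integrableD.
Qed.

Lemma bdd_cst c : bddSU2 (fun=> c).
Proof. by split; [exact: cmeas_cst|exists (cabs c)]. Qed.
Lemma bddM f g : bddSU2 f -> bddSU2 g -> bddSU2 (fun x => f x * g x).
Proof.
move=> [mf [A fA]] [mg [B gB]]; split; first exact: cmeasM.
exists (A * B) => x sx; rewrite cabsM ler_pM ?cabs_ge0//; [exact: fA|exact: gB].
Qed.
Lemma bddD f g : bddSU2 f -> bddSU2 g -> bddSU2 (fun x => f x + g x).
Proof.
move=> [mf [A fA]] [mg [B gB]]; split; first exact: cmeasD.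
exists (A + B) => x sx; rewrite (le_trans (cabsD _ _))// lerD//; [exact: fA|exact: gB].
Qed.
Lemma bddX f n : bddSU2 f -> bddSU2 (fun x => f x ^+ n).
Proof.
move=> bf; elim: n => [|n IH]; first exact: bdd_cst.
by under eq_fun do rewrite exprS; exact: bddM.
Qed.
Lemma bdd_comp f (phi : X -> X) : measurable_fun setT phi ->
  (forall x, SU2 x -> SU2 (phi x)) -> bddSU2 f -> bddSU2 (fun x => f (phi x)).
Proof.
move=> mphi sphi [mf [A fA]]; split; first exact: cmeas_comp.
by exists A => x sx; apply/fA/sphi.
Qed.

Lemma L1Z c f : L1 mu f -> L1 mu (fun x => c * f x).
Proof.
move=> lf; under eq_fun do rewrite mulrC.
by apply: L1M => //; exact: bdd_cst.
Qed.
Lemma L1N f : L1 mu f -> L1 mu (fun x => - f x).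
Proof.
by move=> /(L1Z (-1)); under eq_fun do rewrite mulN1r.
Qed.
Lemma L1B f g : L1 mu f -> L1 mu g -> L1 mu (fun x => f x - g x).
Proof. by move=> lf lg; exact: (L1D lf (L1N lg)). Qed.
Lemma L1_0 : L1 mu (fun=> 0).
Proof. exact/L1_bdd/bdd_cst. Qed.
Lemma L1_sum (F : nat -> X -> complex R) n : (forall i, L1 mu (F i)) ->
  L1 mu (fun x => \sum_(i < n) F i x).
Proof.
move=> lF; elim: n => [|n IH].
  by under eq_fun do rewrite big_ord0; exact: L1_0.
by under eq_fun do rewrite big_ord_recr/=; exact: L1D.
Qed.

Lemma ae_eq_cint f g : cmeas f -> cmeas g -> {ae mu, forall x, f x = g x} ->
  cint mu f = cint mu g.
Proof.
move=> [rf jf] [rg jg] fg; congr Complex; congr fine; apply: ae_eq_integral => //;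
  try exact/measurable_EFinP.
  by move: fg; apply: filterS => x -> _.
by move: fg; apply: filterS => x -> _.
Qed.

Lemma eq_cint f g : cmeas f -> cmeas g -> (forall x, SU2 x -> f x = g x) ->
  cint mu f = cint mu g.
Proof.
by move=> mf mg fg; apply: ae_eq_cint => //; have := ae_SU2; apply: filterS.
Qed.

Lemma cintD f g : L1 mu f -> L1 mu g ->
  cint mu (fun x => f x + g x) = cint mu f + cint mu g.
Proof.
move=> [rf jf] [rg jg]; rewrite /cint.
under eq_Rintegral do rewrite reD.
under [X in Complex _ X]eq_Rintegral do rewrite imD.
by rewrite !RintegralD.
Qed.

Lemma cintZ c f : L1 mu f -> cint mu (fun x => c * f x) = c * cint mu f.
Proof.
move=> [rf jf]; rewrite /cint.
under eq_Rintegral do rewrite reM.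
under [X in Complex _ X]eq_Rintegral do rewrite imM.
have iZ (u : X -> R) (a : R) : mu.-integrable setT (EFin \o u) ->
  mu.-integrable setT (EFin \o (fun x => a * u x)).
  by move=> iu; rewrite /comp; under eq_fun do rewrite EFinM; exact: integrableZl.
rewrite RintegralB ?RintegralD ?RintegralZl//; try exact: iZ.
by apply: complex_ext; rewrite ?reM ?imM.
Qed.
Lemma cintZr c f : L1 mu f -> cint mu (fun x => f x * c) = cint mu f * c.
Proof.
move=> lf; rewrite mulrC -cintZ//; congr cint; apply/funext => x; exact: mulrC.
Qed.
Lemma cintN f : L1 mu f -> cint mu (fun x => - f x) = - cint mu f.
Proof.
by move=> lf; rewrite -mulN1r -cintZ//; congr cint; apply/funext => x; rewrite mulN1r.
Qed.
Lemma cintB f g : L1 mu f -> L1 mu g ->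
  cint mu (fun x => f x - g x) = cint mu f - cint mu g.
Proof. by move=> lf lg; rewrite (cintD lf (L1N lg)) cintN. Qed.
Lemma cint0 : cint mu (fun=> 0) = 0.
Proof. by have := cintZ 0 L1_0; under eq_fun do rewrite mul0r; rewrite mul0r. Qed.
Lemma cint_sum (F : nat -> X -> complex R) n : (forall i, L1 mu (F i)) ->
  cint mu (fun x => \sum_(i < n) F i x) = \sum_(i < n) cint mu (F i).
Proof.
move=> lF; elim: n => [|n IH].
  by under eq_fun do rewrite big_ord0; rewrite big_ord0 cint0.
under eq_fun do rewrite big_ord_recr/=.
by rewrite cintD// ?IH ?big_ord_recr//; exact: L1_sum.
Qed.

Lemma nrm1_ge0 f : 0 <= nrm1 mu f.
Proof. by apply: Rintegral_ge0 => x _; exact: cabs_ge0. Qed.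

Lemma le_nrm1 f g : L1 mu f -> L1 mu g ->
  (forall x, SU2 x -> cabs (f x) <= cabs (g x)) -> nrm1 mu f <= nrm1 mu g.
Proof.
move=> lf lg fg; apply: fine_le.
- by apply: integrable_fin_num => //; exact: L1_integrable_cabs.
- by apply: integrable_fin_num => //; exact: L1_integrable_cabs.
- apply: ae_ge0_le_integral => //.
  + by move=> x _; rewrite lee_fin cabs_ge0.
  + by have /integrableP[] := L1_integrable_cabs lf.
  + by move=> x _; rewrite lee_fin cabs_ge0.
  + by have /integrableP[] := L1_integrable_cabs lg.
  + by have := ae_SU2; apply: filterS => x sx _; rewrite lee_fin fg.
Qed.

Lemma nrm1Z c f : L1 mu f -> nrm1 mu (fun x => c * f x) = cabs c * nrm1 mu f.
Proof.
move=> /L1_integrable_cabs lf; rewrite /nrm1.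
by under eq_Rintegral do rewrite cabsM; rewrite RintegralZl.
Qed.

Lemma nrm1D f g : L1 mu f -> L1 mu g ->
  nrm1 mu (fun x => f x + g x) <= nrm1 mu f + nrm1 mu g.
Proof.
move=> lf lg; have [? ? ?] := And3 (L1_integrable_cabs lf) (L1_integrable_cabs lg)
  (L1_integrable_cabs (L1D lf lg)).
rewrite /nrm1 -RintegralD//; apply: le_Rintegral => //.
  by rewrite /comp; under eq_fun do rewrite EFinD; exact: integrableD.
by move=> x _; exact: cabsD.
Qed.

Lemma nrm1M_le f k C : L1 mu f -> bddSU2 k -> (forall x, SU2 x -> cabs (k x) <= C) ->
  nrm1 mu (fun x => f x * k x) <= C * nrm1 mu f.
Proof.
move=> lf bk kC.
have C0 : 0 <= C by rewrite (le_trans (cabs_ge0 (k (oneG R))))// kC//; exact: SU2_1.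
rewrite -[C]ger0_norm// -cabs_real -nrm1Z//.
apply: le_nrm1; [exact: L1M|exact: L1Z|move=> x sx].
by rewrite !cabsM cabs_real ger0_norm// mulrC ler_wpM2r ?cabs_ge0// kC.
Qed.

(* Rotating [f] by the phase of its integral reduces this to the real case. *)
Lemma cabs_cint_le f : L1 mu f -> cabs (cint mu f) <= nrm1 mu f.
Proof.
move=> lf; set I := cint mu f.
have [->|I0] := eqVneq (cabs I) 0; first exact: nrm1_ge0.
have Ip : 0 < cabs I by rewrite lt_neqAle eq_sym I0 cabs_ge0.
rewrite -(ler_pM2l Ip) -[X in X * nrm1 mu f]cabs_cconj -nrm1Z//.
rewrite -expr2 (_ : cabs I ^+ 2 = re (cconj I * I)); last first.
  by rewrite mulrC mul_cconj.
rewrite -cintZ//; apply: le_Rintegral => //.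
- exact: (L1Z _ lf).1.
- exact/L1_integrable_cabs/L1Z.
- by move=> x _; rewrite (le_trans (ler_norm _))// re_le_cabs.
Qed.

Lemma cint_mul_le f k C : L1 mu f -> bddSU2 k -> (forall x, SU2 x -> cabs (k x) <= C) ->
  cabs (cint mu (fun x => f x * k x)) <= C * nrm1 mu f.
Proof.
move=> lf bk kC; apply: le_trans (nrm1M_le lf bk kC).
exact/cabs_cint_le/L1M.
Qed.

(** Invariance is expressed by integrals of nonnegative functions, the form in which Tonelli's
    theorem yields it for inversion; null sets and integrable functions follow from it. *)
Definition mpres (phi : X -> X) := measurable_fun setT phi /\
  forall F : X -> \bar R, measurable_fun setT F -> (forall x, 0 <= F x)%E ->
  (\int[mu]_x F (phi x) = \int[mu]_x F x)%E.

Lemma mpres_comp phi psi : mpres phi -> mpres psi -> mpres (fun x => phi (psi x)).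
Proof.
move=> [m1 p1] [m2 p2]; split; first exact: (measurableT_comp m1 m2).
move=> F mF F0; rewrite (p2 (fun x => F (phi x))) ?p1//.
exact: (measurableT_comp mF m1).
Qed.

Lemma mpres_mulGl (g : X) : SU2 g -> mpres (mulG g).
Proof.
move=> sg; have mg : measurable_fun setT (mulG g).
  by apply: measurable_mulG => //; exact: measurable_cst.
split => // F mF F0.
transitivity (\int[pushforward mu (mulG g)]_x F x)%E; last first.
  by apply: eq_measure_integral => A mA _; rewrite /pushforward/=; apply: haar.2.
by rewrite ge0_integral_pushforward//= preimage_setT.
Qed.

Lemma integral_SU2_cst (F : X -> \bar R) (c : \bar R) : measurable_fun setT F ->
  (forall x, 0 <= F x)%E -> (forall x, SU2 x -> F x = c) -> (\int[mu]_x F x = c)%E.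
Proof.
move=> mF F0 Fc; transitivity (\int[mu]_x (cst c x))%E.
  apply: ae_eq_integral => //.
  by have := ae_SU2; apply: filterS => x sx _; rewrite Fc.
by rewrite integral_cst// [X in (_ * X)%E](probability_setT mu) mule1.
Qed.

(* Averaging [F (y^-1 x)] over both variables in either order gives the integral
   of [F] and the integral of [F] after inversion, respectively. *)
Lemma mpres_invG : mpres (@invG R).
Proof.
have minv : measurable_fun setT (@invG R) by exact: measurable_invG.
split => // F mF F0.
pose H (z : X * X) := F (mulG (invG z.2) z.1).
have mH : measurable_fun setT H.
  apply: (measurableT_comp mF); apply: measurable_mulG => //.
  exact: measurable_invG.
have H0 z : (0 <= H z)%E by exact: F0.
have := @fubini_tonelli _ _ _ _ R mu mu H mH H0.
rewrite (@integral_SU2_cst (fun x => \int[mu]_y H (x, y))%E (\int[mu]_x F (invG x))%E).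
- rewrite (@integral_SU2_cst (fun y => \int[mu]_x H (x, y))%E (\int[mu]_x F x)%E) //.
  + exact: measurable_fun_fubini_tonelli_G.
  + by move=> x; exact: integral_ge0.
  + by move=> y /SU2V sy; rewrite (mpres_mulGl sy).2.
- exact: measurable_fun_fubini_tonelli_F.
- by move=> x; exact: integral_ge0.
- move=> x /SU2V sx; rewrite -((mpres_mulGl sx).2 (fun x => F (invG x))) //.
  + by apply: eq_integral => y _; rewrite /H/= invGM invGK.
  + exact: measurableT_comp.
Qed.

Lemma mpres_integral phi (h : X -> \bar R) : mpres phi -> measurable_fun setT h ->
  (\int[mu]_x h (phi x) = \int[mu]_x h x)%E.
Proof.
move=> [m p] mh; rewrite integralE [RHS]integralE.
rewrite -(p (h ^\+)%E) -?(p (h ^\-)%E)//.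
- by congr (_ - _)%E; apply: eq_integral => x _; rewrite !(funeposE, funenegE).
- exact: measurable_funeneg.
- exact: measurable_funepos.
Qed.

Lemma cint_mpres phi f : mpres phi -> cmeas f -> cint mu (fun x => f (phi x)) = cint mu f.
Proof.
move=> p [rf jf]; congr Complex; congr fine.
  by apply: (mpres_integral (h := fun x => (re (f x))%:E)) => //; exact/measurable_EFinP.
by apply: (mpres_integral (h := fun x => (im (f x))%:E)) => //; exact/measurable_EFinP.
Qed.

Lemma integrable_mpres phi (h : X -> \bar R) : mpres phi ->
  mu.-integrable setT h -> mu.-integrable setT (fun x => h (phi x)).
Proof.
move=> p /integrableP[mh hoo]; apply/integrableP; split.
  exact: (measurableT_comp mh p.1).
rewrite (mpres_integral (h := fun x => `|h x|%E))//; exact: measurableT_comp.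
Qed.

Lemma L1_mpres phi f : mpres phi -> L1 mu f -> L1 mu (fun x => f (phi x)).
Proof.
move=> p [rf jf]; split.
  exact: (integrable_mpres (h := fun x => (re (f x))%:E)).
exact: (integrable_mpres (h := fun x => (im (f x))%:E)).
Qed.

Lemma ae_mpres phi (P : X -> Prop) : mpres phi ->
  {ae mu, forall x, P x} -> {ae mu, forall x, P (phi x)}.
Proof.
move=> [mphi p] [A [mA A0 PA]].
have mB : measurable (phi @^-1` A).
  by rewrite -[X in measurable X]setTI; exact: mphi.
exists (phi @^-1` A); split => //; last by move=> x; apply: PA.
have iE B : measurable B -> (\int[mu]_x (\1_B x)%:E = mu B)%E.
  by move=> ?; rewrite (@integral_indic _ _ _ mu setT measurableT)// setIT.
rewrite -A0 -(iE _ mA) -(iE _ mB) -(p (EFin \o \1_A))//.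
- exact/measurable_EFinP/measurable_indic.
- by move=> x; rewrite lee_fin.
Qed.

Lemma ae_exists (P : X -> Prop) : {ae mu, forall x, P x} -> exists x, P x.
Proof.
move=> [A [mA A0 PA]]; apply: contrapT => /forallNP nP.
have AT : A = setT by apply/seteqP; split => // x _; apply/PA/nP.
by move: A0; rewrite AT (probability_setT mu) => /eqP; rewrite onee_eq0.
Qed.

End Integral.

(** * Fubini's theorem for iterated real and complex integrals *)

Section Fubini.
Context {R : realType} (mu : probability (SU2car R) R).
Local Notation X := (SU2car R).

Section RealFubini.
Variable h : X * X -> R.
Hypothesis mh : measurable_fun setT h.
Hypothesis hoo : (\int[mu]_y \int[mu]_x `|(h (x, y))%:E| < +oo)%E.

Let H := fun z => (h z)%:E.
Let iH : (mu \x mu)%E.-integrable setT H.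
Proof. by apply/integrable21ltyP => //; exact/measurable_EFinP. Qed.

Lemma fubini_ae1 : {ae mu, forall x, mu.-integrable setT (fun y => (h (x, y))%:E)}.
Proof. exact: ae_integrable1 iH. Qed.

(** [Rintegral] is [fine] of the extended integral and returns 0 at infinite values, so agreement is
    guaranteed only at integrable slices, which are almost all. *)
Let aeF : ae_eq mu setT (fun x => (\int[mu]_y h (x, y))%:E)
                        (fun x => \int[mu]_y (h (x, y))%:E)%E.
Proof.
have := fubini_ae1; apply: filterS => x ix _.
by rewrite /Rintegral fineK//; exact: integrable_fin_num.
Qed.

Let aeG : ae_eq mu setT (fun y => (\int[mu]_x h (x, y))%:E)
                        (fun y => \int[mu]_x (h (x, y))%:E)%E.
Proof.
have := ae_integrable2 iH; apply: filterS => x ix _.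
by rewrite /Rintegral fineK//; exact: integrable_fin_num.
Qed.

Lemma measurable_Rintegral1 : measurable_fun setT (fun x => \int[mu]_y h (x, y)).
Proof.
apply: (measurableT_comp (f := fine)); first exact: fine_measurable.
exact: measurable_fubini_F iH.
Qed.

Lemma measurable_Rintegral2 : measurable_fun setT (fun y => \int[mu]_x h (x, y)).
Proof.
apply: (measurableT_comp (f := fine)); first exact: fine_measurable.
exact: measurable_fubini_G iH.
Qed.

Lemma integrable_Rintegral1 : mu.-integrable setT (fun x => (\int[mu]_y h (x, y))%:E).
Proof.
apply: (le_integrable _ _ _ (integrable_fubini_F iH)) => //.
  by apply/measurable_EFinP; exact: measurable_Rintegral1.
(* [fine] sends infinite values to 0, so it never increases the absolute value. *)
move=> x _; rewrite /Rintegral /fubini_F /H; by case: (integral _ _ _) => //=; rewrite normr0 leey.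
Qed.

Lemma Rfubini : \int[mu]_x \int[mu]_y h (x, y) = \int[mu]_y \int[mu]_x h (x, y).
Proof.
congr fine.
rewrite (ae_eq_integral _ _ measurableT _ _ aeF); last 2 first.
- by apply/measurable_EFinP; exact: measurable_Rintegral1.
- exact: measurable_fubini_F iH.
rewrite [RHS](ae_eq_integral _ _ measurableT _ _ aeG); last 2 first.
- by apply/measurable_EFinP; exact: measurable_Rintegral2.
- exact: measurable_fubini_G iH.
exact: (Fubini iH).
Qed.

End RealFubini.

Section ComplexFubini.
Variable H : X * X -> complex R.
Hypothesis mH : cmeas H.
Hypothesis Hoo : (\int[mu]_y \int[mu]_x (cabs (H (x, y)))%:E < +oo)%E.

Let part_lty (h : X * X -> R) : measurable_fun setT h ->
  (forall z, `|h z| <= cabs (H z)) ->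
  (\int[mu]_y \int[mu]_x `|(h (x, y))%:E| < +oo)%E.
Proof.
move=> mh hH; apply: le_lt_trans Hoo.
have mhE : measurable_fun setT (fun z => `|(h z)%:E|%E).
  exact/measurableT_comp/measurable_EFinP.
have mHE : measurable_fun setT (fun z => (cabs (H z))%:E).
  by apply/measurable_EFinP; exact: measurable_cabs.
apply: ge0_le_integral => //.
- by move=> y _; exact: integral_ge0.
- exact: (measurable_fun_fubini_tonelli_G _ mhE).
- by apply: (measurable_fun_fubini_tonelli_G _ mHE) => z; rewrite lee_fin cabs_ge0.
- move=> y _; apply: ge0_le_integral => //.
  + exact: (measurable_fun_pair1 y mhE).
  + exact: (measurable_fun_pair1 y mHE).
  + by move=> x _; rewrite lee_fin hH.
Qed.

Let re_lty := part_lty mH.1 (fun z => re_le_cabs (H z)).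
Let im_lty := part_lty mH.2 (fun z => im_le_cabs (H z)).

Lemma L1_cint1 : L1 mu (fun x => cint mu (fun y => H (x, y))).
Proof.
by split; [exact: (integrable_Rintegral1 mH.1 re_lty)|exact: (integrable_Rintegral1 mH.2 im_lty)].
Qed.

Lemma ae_L1_1 : {ae mu, forall x, L1 mu (fun y => H (x, y))}.
Proof.
have := fubini_ae1 mH.2 im_lty; have := fubini_ae1 mH.1 re_lty.
by apply: filterS2.
Qed.

Lemma cmeas_cint2 : cmeas (fun y => cint mu (fun x => H (x, y))).
Proof.
by split; [exact: (measurable_Rintegral2 mH.1 re_lty)|exact: (measurable_Rintegral2 mH.2 im_lty)].
Qed.

Lemma cint_fubini : cint mu (fun x => cint mu (fun y => H (x, y))) =
  cint mu (fun y => cint mu (fun x => H (x, y))).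
Proof. by congr Complex; [exact: (Rfubini mH.1 re_lty)|exact: (Rfubini mH.2 im_lty)]. Qed.

(** Minkowski's inequality for integrals: the triangle inequality holds on almost every slice, and
    Tonelli's theorem exchanges the order on the right. For convolution kernels it becomes
    submultiplicativity of the norm. *)
Lemma nrm1_cint1_le : is_haar mu -> nrm1 mu (fun x => cint mu (fun y => H (x, y))) <=
  fine (\int[mu]_y \int[mu]_x (cabs (H (x, y)))%:E)%E.
Proof.
move=> haar.
have mHE : measurable_fun setT (fun z => (cabs (H z))%:E).
  by apply/measurable_EFinP; exact: measurable_cabs.
have H0 z : (0 <= (cabs (H z))%:E)%E by rewrite lee_fin cabs_ge0.
apply: fine_le.
- apply: integrable_fin_num => //; exact/L1_integrable_cabs/L1_cint1.
- rewrite ge0_fin_numE; first exact: Hoo.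
  by apply: integral_ge0 => y _; apply: integral_ge0 => x _; exact: H0 (x, y).
rewrite -(@fubini_tonelli _ _ _ _ R mu mu _ mHE H0).
apply: ae_ge0_le_integral => //.
- by move=> x _; rewrite lee_fin cabs_ge0.
- by have /integrableP[] := L1_integrable_cabs L1_cint1.
- by move=> x _; exact: integral_ge0.
- exact: (measurable_fun_fubini_tonelli_F _ mHE).
have := ae_L1_1; apply: filterS => x l1 _.
apply: (@le_trans _ _ (nrm1 mu (fun y => H (x, y)))%:E).
  by rewrite lee_fin; exact: cabs_cint_le.
by rewrite /nrm1 /Rintegral fineK//; apply: integrable_fin_num => //; exact: L1_integrable_cabs.
Qed.

End ComplexFubini.

End Fubini.

(** * Convolution *)
Section Convolution.
Context {R : realType} (mu : probability (SU2car R) R).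
Hypothesis haar : is_haar mu.
Local Notation X := (SU2car R).
Implicit Types f g k : X -> complex R.

Lemma cmeas_conv_kernel f g : cmeas f -> cmeas g ->
  cmeas (fun z : X * X => f z.2 * g (mulG (invG z.2) z.1)).
Proof.
move=> mf mg; apply: cmeasM; first exact: (cmeas_comp measurable_snd mf).
apply: (cmeas_comp _ mg); apply: measurable_mulG => //.
exact: measurable_invG.
Qed.

(** For [y] in SU(2) the inner integral of [cabs g] is over a left translate and does not depend on
    [y]. The identity provides the finiteness that Fubini's theorem asks for as well as the norm
    bound for convolutions. *)
Lemma integral_conv_kernel f g : L1 mu f -> L1 mu g ->
  (\int[mu]_y \int[mu]_x (cabs (f y * g (mulG (invG y) x)))%:E)%E =
  (nrm1 mu f * nrm1 mu g)%:E.
Proof.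
move=> lf lg.
have [/integrableP[mcf _] /integrableP[mcg _]] := conj (L1_integrable_cabs lf) (L1_integrable_cabs lg).
have mK : measurable_fun setT (fun z : X * X => (cabs (f z.2 * g (mulG (invG z.2) z.1)))%:E).
  by apply/measurable_EFinP; exact: measurable_cabs (cmeas_conv_kernel (L1_cmeas lf) (L1_cmeas lg)).
have fE h : L1 mu h -> (\int[mu]_x (cabs (h x))%:E = (nrm1 mu h)%:E)%E.
  by move=> lh; rewrite /nrm1 /Rintegral fineK//; apply: integrable_fin_num => //;
    exact: L1_integrable_cabs.
transitivity (\int[mu]_y ((nrm1 mu g)%:E * (cabs (f y))%:E))%E; last first.
  rewrite ge0_integralZl ?lee_fin ?nrm1_ge0 ?fE//; first by rewrite -EFinM mulrC.
  by move=> x _; rewrite lee_fin cabs_ge0.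
apply: ae_eq_integral => //.
- apply: (measurable_fun_fubini_tonelli_G _ mK) => z; by rewrite lee_fin cabs_ge0.
- exact: emeasurable_funM.
have := ae_SU2 haar; apply: filterS => y sy _.
under eq_integral do rewrite cabsM EFinM.
rewrite ge0_integralZl//.
- rewrite muleC; congr (_ * _)%E; rewrite -fE//.
  apply: (mpres_mulGl haar (SU2V sy)).2 (fun x => (cabs (g x))%:E) _ _ => //.
  by move=> x; rewrite lee_fin cabs_ge0.
- exact: (measurableT_comp mcg (mpres_mulGl haar (SU2V sy)).1).
- by move=> x _; rewrite lee_fin cabs_ge0.
- by rewrite lee_fin cabs_ge0.
Qed.

Lemma L1_conv f g : L1 mu f -> L1 mu g -> L1 mu (conv mu f g).
Proof.
move=> lf lg; apply: (@L1_cint1 _ mu (fun z => f z.2 * g (mulG (invG z.2) z.1))).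
  exact: cmeas_conv_kernel (L1_cmeas lf) (L1_cmeas lg).
by have := ltry (nrm1 mu f * nrm1 mu g); rewrite -(integral_conv_kernel lf lg).
Qed.

Lemma nrm1_conv f g : L1 mu f -> L1 mu g ->
  nrm1 mu (conv mu f g) <= nrm1 mu f * nrm1 mu g.
Proof.
move=> lf lg.
have e := integral_conv_kernel lf lg.
have -> : nrm1 mu f * nrm1 mu g =
    fine (\int[mu]_y \int[mu]_x (cabs (f y * g (mulG (invG y) x)))%:E)%E by rewrite e.
apply: (@nrm1_cint1_le _ mu (fun z => f z.2 * g (mulG (invG z.2) z.1))) => //.
  exact: cmeas_conv_kernel (L1_cmeas lf) (L1_cmeas lg).
by have := ltry (nrm1 mu f * nrm1 mu g); rewrite -e.
Qed.

(** Fubini's theorem and the substitution [x = y z]. The inner integral enters through a closed form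
    [M], prescribed only on the conull set SU(2). *)
Lemma cint_conv f g k M : L1 mu f -> L1 mu g -> bddSU2 k -> cmeas M ->
  (forall y, SU2 y -> cint mu (fun z => g z * k (mulG y z)) = M y) ->
  cint mu (fun x => conv mu f g x * k x) = cint mu (fun y => f y * M y).
Proof.
move=> lf lg bk mM kM; have [mk [C kC]] := bk.
have [mf mg] := conj (L1_cmeas lf) (L1_cmeas lg).
pose H (z : X * X) := f z.2 * g (mulG (invG z.2) z.1) * k z.1.
have mK := cmeas_conv_kernel mf mg.
have mH : cmeas H by apply: cmeasM => //; exact: (cmeas_comp measurable_fst mk).
have C0 : 0 <= C by rewrite (le_trans (cabs_ge0 (k (oneG R))))// kC//; exact: SU2_1.
have mHE : measurable_fun setT (fun z => (cabs (H z))%:E).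
  by apply/measurable_EFinP; exact: measurable_cabs.
(* Absorbing the bound [C] of [k] into [f] makes the majorant of [H] a convolution kernel again,
   with known iterated integral. *)
have lCf := L1Z haar (Complex C 0) lf.
have mCf : measurable_fun setT
    (fun z : X * X => (cabs (Complex C 0 * f z.2 * g (mulG (invG z.2) z.1)))%:E).
  by apply/measurable_EFinP; exact: measurable_cabs (cmeas_conv_kernel (L1_cmeas lCf) mg).
have Hoo : (\int[mu]_y \int[mu]_x (cabs (H (x, y)))%:E < +oo)%E.
  apply: (@le_lt_trans _ _ (nrm1 mu (fun x => Complex C 0 * f x) * nrm1 mu g)%:E);
    last by rewrite ltry.
  rewrite -(integral_conv_kernel lCf lg); apply: ge0_le_integral => //.
  - by move=> y _; apply: integral_ge0 => x _; rewrite lee_fin cabs_ge0.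
  - by apply: (measurable_fun_fubini_tonelli_G _ mHE) => z; rewrite lee_fin cabs_ge0.
  - by apply: (measurable_fun_fubini_tonelli_G _ mCf) => z; rewrite lee_fin cabs_ge0.
  - move=> y _; apply: ae_ge0_le_integral => //.
    + by move=> x _; rewrite lee_fin cabs_ge0.
    + exact: (measurable_fun_pair1 y mHE).
    + by move=> x _; rewrite lee_fin cabs_ge0.
    + exact: (measurable_fun_pair1 y mCf).
    + have := ae_SU2 haar; apply: filterS => x sx _.
      rewrite lee_fin /H/= !cabsM cabs_real ger0_norm// [leLHS]mulrC -(mulrA C).
      by rewrite ler_wpM2r ?mulr_ge0 ?cabs_ge0// kC.
have Koo : (\int[mu]_y \int[mu]_x (cabs (f y * g (mulG (invG y) x)))%:E < +oo)%E.
  by have := ltry (nrm1 mu f * nrm1 mu g); rewrite -(integral_conv_kernel lf lg).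
transitivity (cint mu (fun x => cint mu (fun y => H (x, y)))).
  have c1 : cmeas (fun x => conv mu f g x * k x).
    by apply: cmeasM => //; exact/L1_cmeas/L1_conv.
  have c2 := L1_cmeas (L1_cint1 mH Hoo).
  apply: ae_eq_cint => //.
  have := ae_L1_1 mK Koo; apply: filterS => x lx.
  by rewrite /conv -cintZr.
rewrite (cint_fubini mH Hoo); apply: eq_cint => //.
- exact: cmeas_cint2 mH Hoo.
- exact: cmeasM.
move=> y sy; rewrite -kM// /H /=.
have sy' := SU2V sy.
have lgk : L1 mu (fun x => g (mulG (invG y) x) * k x).
  by apply: L1M => //; exact: (L1_mpres (mpres_mulGl haar sy') lg).
have -> : cint mu (fun z => g z * k (mulG y z)) =
    cint mu (fun x => g (mulG (invG y) x) * k x).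
  rewrite -(cint_mpres (mpres_mulGl haar sy') (f := fun z => g z * k (mulG y z))).
    by congr cint; apply/funext => x; rewrite mulVKG.
  by apply: cmeasM => //; exact: (cmeas_comp (mpres_mulGl haar sy).1 mk).
by rewrite -cintZ//; congr cint; apply/funext => x; rewrite mulrA.
Qed.

End Convolution.

(** * Polynomial functions and conjugation invariance *)
Section Polynomials.
Variable R : realType.
Local Notation X := (SU2car R).
Implicit Types f g : X -> complex R.

(** Every index above 2 stands for the last coordinate, so words of natural numbers need no range
    condition. *)
Definition coordG (i : nat) (x : X) : R :=
  match i with 0 => x.1.1 | 1 => x.1.2 | 2 => x.2.1 | _ => x.2.2 end.

(** Words of coordinates form a countable type: a statement true almost everywhere for each monomial
    is then true almost everywhere for all of them together. *)
Definition mono (s : seq nat) (x : X) : complex R := \prod_(i <- s) (coordG i x)%:C%C.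

(** Polynomials serve as test kernels because they are bounded on SU(2), stable under translations
    and inversion, and linear in countably many monomials. *)
Inductive pol : (X -> complex R) -> Prop :=
| pol0 : pol (fun=> 0)
| pol_cons c s f : pol f -> pol (fun x => c * mono s x + f x).

Lemma eq_pol f g : f =1 g -> pol f -> pol g.
Proof. by move/funext => ->. Qed.

Lemma polD f g : pol f -> pol g -> pol (fun x => f x + g x).
Proof.
move=> pf pg; elim: pf => [|c s f0 _ IH]; first by under eq_fun do rewrite add0r.
by under eq_fun do rewrite -addrA; exact: pol_cons.
Qed.
Lemma polZ k f : pol f -> pol (fun x => k * f x).
Proof.
elim=> [|c s f0 _ IH]; first by under eq_fun do rewrite mulr0; exact: pol0.
by under eq_fun do rewrite mulrDr mulrA; exact: pol_cons.
Qed.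
Lemma pol_mono s : pol (mono s).
Proof.
by apply: (eq_pol _ (pol_cons 1 s pol0)) => x; rewrite mul1r addr0.
Qed.
Lemma pol_mulmono s f : pol f -> pol (fun x => mono s x * f x).
Proof.
elim=> [|c t f0 _ IH]; first by under eq_fun do rewrite mulr0; exact: pol0.
apply: (eq_pol _ (pol_cons c (s ++ t) IH)) => x.
by rewrite /mono big_cat/= mulrDr mulrCA.
Qed.
Lemma polM f g : pol f -> pol g -> pol (fun x => f x * g x).
Proof.
move=> pf pg; elim: pf => [|c s f0 _ IH].
  by under eq_fun do rewrite mul0r; exact: pol0.
under eq_fun do rewrite mulrDl -mulrA.
by apply: polD => //; apply: polZ; exact: pol_mulmono.
Qed.
Lemma pol_cst c : pol (fun=> c).
Proof.
by apply: (eq_pol _ (pol_cons c [::] pol0)) => x; rewrite /mono big_nil mulr1 addr0.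
Qed.
Lemma polX f n : pol f -> pol (fun x => f x ^+ n).
Proof.
move=> pf; elim: n => [|n IH]; first exact: pol_cst.
by under eq_fun do rewrite exprS; exact: polM.
Qed.
Lemma polN f : pol f -> pol (fun x => - f x).
Proof. by move=> /(polZ (-1)); apply: eq_pol => x; rewrite mulN1r. Qed.
Lemma polB f g : pol f -> pol g -> pol (fun x => f x - g x).
Proof. by move=> pf pg; apply: polD => //; exact: polN. Qed.
Lemma pol_coord i : pol (fun x => (coordG i x)%:C%C).
Proof. by apply: (eq_pol _ (pol_mono [:: i])) => x; rewrite /mono big_seq1. Qed.

Lemma pol_comp f (phi : X -> X) :
  (forall i, pol (fun x => (coordG i (phi x))%:C%C)) -> pol f ->
  pol (fun x => f (phi x)).
Proof.
move=> pphi; elim=> [|c s g _ IH]; first exact: pol0.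
apply: polD => //; apply: polZ; elim: s => [|i s IHs].
  by under eq_fun do rewrite /mono big_nil; exact: pol_cst.
by under eq_fun do rewrite /mono big_cons; exact: polM.
Qed.

Lemma complexE (a b : R) : Complex a b = a%:C%C + Complex 0 1 * b%:C%C.
Proof. by apply: complex_ext; rewrite ?(reD, imD, reM, imM)/=; ring. Qed.

Lemma pol_alpha : pol (@alpha R).
Proof.
apply: (eq_pol _ (polD (pol_coord 0) (polZ (Complex 0 1) (pol_coord 1)))) => x.
by rewrite /alpha [RHS]complexE.
Qed.
Lemma pol_alphaJ : pol (fun x => cconj (alpha x)).
Proof.
apply: (eq_pol _ (polD (pol_coord 0) (polZ (- Complex 0 1) (pol_coord 1)))) => x.
by rewrite /cconj/= [RHS]complexE rmorphN/= mulrN mulNr.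
Qed.
Lemma pol_beta : pol (@beta R).
Proof.
apply: (eq_pol _ (polD (pol_coord 2) (polZ (Complex 0 1) (pol_coord 3)))) => x.
by rewrite /beta [RHS]complexE.
Qed.
Lemma pol_betaJ : pol (fun x => cconj (beta x)).
Proof.
apply: (eq_pol _ (polD (pol_coord 2) (polZ (- Complex 0 1) (pol_coord 3)))) => x.
by rewrite /cconj/= [RHS]complexE rmorphN/= mulrN mulNr.
Qed.

(** Real and imaginary parts are combinations of a function and its conjugate, so composition with
    the group operations reduces to [alpha], [beta] and their conjugates. *)
Lemma pol_coord_ab (f g : X -> complex R) : pol f -> pol g ->
  pol (fun x => cconj (f x)) -> pol (fun x => cconj (g x)) ->
  forall i, pol (fun x => (coordG i (of_ab (f x) (g x)))%:C%C).
Proof.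
move=> pf pg pf' pg'.
have reE (z : complex R) : (re z)%:C%C = Complex (2^-1) 0 * (z + cconj z).
  by apply: complex_ext; rewrite ?(reD, imD, reM, imM)/=; field.
have imE (z : complex R) : (im z)%:C%C = Complex 0 (- 2^-1) * (z - cconj z).
  by apply: complex_ext; rewrite ?(reD, imD, reM, imM, reN, imN)/=; field.
by move=> [|[|[|i]]] /=; under eq_fun do rewrite ?reE ?imE; apply: polZ;
  [apply: polD|apply: polB|apply: polD|apply: polB].
Qed.

Lemma cconjD (z w : complex R) : cconj (z + w) = cconj z + cconj w.
Proof. by case: z w => [a b] [c d]; rewrite /cconj/= opprD. Qed.
Lemma cconjN (z : complex R) : cconj (- z) = - cconj z.
Proof. by case: z. Qed.
Lemma cconjK (z : complex R) : cconj (cconj z) = z.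
Proof. by case: z => a b; rewrite /cconj/= opprK. Qed.

Ltac pol_tac := repeat first
  [exact: pol_alpha|exact: pol_alphaJ|exact: pol_beta|exact: pol_betaJ
  |exact: pol_cst|apply: polB|apply: polD|apply: polM|apply: polN].

Lemma pol_mulGl (h : X) f : pol f -> pol (fun x => f (mulG h x)).
Proof.
apply: pol_comp; rewrite /mulG; apply: pol_coord_ab;
  under eq_fun do rewrite ?(cconjD, cconjN, cconj_mul, cconjK); pol_tac.
Qed.
Lemma pol_mulGr (h : X) f : pol f -> pol (fun x => f (mulG x h)).
Proof.
apply: pol_comp; rewrite /mulG; apply: pol_coord_ab;
  under eq_fun do rewrite ?(cconjD, cconjN, cconj_mul, cconjK); pol_tac.
Qed.

Lemma pol_invG f : pol f -> pol (fun x => f (invG x)).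
Proof.
apply: pol_comp; rewrite /invG; apply: pol_coord_ab;
  under eq_fun do rewrite ?(cconjD, cconjN, cconj_mul, cconjK); pol_tac.
Qed.

Lemma bdd_coord i : bddSU2 (fun x => (coordG i x)%:C%C).
Proof.
split.
  have [a b c d] := measurable_coords (@measurable_id _ X setT).
  by split; last exact: measurable_cst; case: i => [|[|[|i]]].
exists 1 => x sx; rewrite cabs_real.
have A := le_trans (re_le_cabs (alpha x)) (cabs_alpha sx).
have B := le_trans (im_le_cabs (alpha x)) (cabs_alpha sx).
have C := le_trans (re_le_cabs (beta x)) (cabs_beta sx).
have D := le_trans (im_le_cabs (beta x)) (cabs_beta sx).
by case: i => [|[|[|i]]].
Qed.

Lemma pol_bdd f : pol f -> bddSU2 f.
Proof.
elim=> [|c s g _ IH]; first exact: bdd_cst.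
apply: bddD => //; apply: bddM; first exact: bdd_cst.
elim: s => [|i s IHs].
  by rewrite /mono; under eq_fun do rewrite big_nil; exact: bdd_cst.
by rewrite /mono; under eq_fun do rewrite big_cons; apply: bddM => //; exact: bdd_coord.
Qed.

End Polynomials.

Section Central.
Context {R : realType} (mu : probability (SU2car R) R).
Hypothesis haar : is_haar mu.
Local Notation X := (SU2car R).
Implicit Types a F : X -> complex R.

Definition twist a F h := cint mu (fun y => a y * F (mulG h y)) =
                          cint mu (fun y => a y * F (mulG y h)).

(** Centrality is applied to [F] after inversion: one convolution then contains [F (x^-1 y)]
    directly, and the substitution [y = x z^-1] brings [F (z x^-1)] into the other. *)
Lemma central_ae_twist a F : ZL1 mu a -> bddSU2 F ->
  {ae mu, forall x, twist a F (invG x)}.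
Proof.
move=> [la ca] bF.
have bG : bddSU2 (fun w => F (invG w)).
  by apply: bdd_comp => //; [exact: measurable_invG|move=> x; exact: SU2V].
have := ca _ (L1_bdd haar bG).
apply: filterS2 (ae_SU2 haar) => x sx; rewrite /conv => e.
transitivity (cint mu (fun y => a y * F (invG (mulG (invG y) x)))).
  by congr cint; apply/funext => y; rewrite invGM invGK.
rewrite e.
have p := mpres_comp (mpres_mulGl haar sx) (mpres_invG haar).
rewrite -(cint_mpres p); last first.
  apply: cmeasM; first exact: bG.1.
  apply: (cmeas_comp _ (L1_cmeas la)).
  by apply: measurable_mulG; [exact: measurable_invG|exact: measurable_cst].
congr cint; apply/funext => z.
by rewrite invGM !invGK mulGVK// mulrC.
Qed.

Lemma twist_pol a h : L1 mu a -> SU2 h ->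
  (forall s, twist a (mono s) h) -> forall F, pol F -> twist a F h.
Proof.
move=> la sh tm F; elim=> [|c s f pf IH].
  by rewrite /twist; congr cint; apply/funext => x; rewrite !mulr0.
have bl g : pol g -> L1 mu (fun y => a y * g (mulG h y)).
  by move=> pg; apply: L1M => //; exact/pol_bdd/pol_mulGl.
have br g : pol g -> L1 mu (fun y => a y * g (mulG y h)).
  by move=> pg; apply: L1M => //; exact/pol_bdd/pol_mulGr.
have pm := pol_mono R s.
rewrite /twist.
under eq_fun do rewrite mulrDr mulrCA.
under [in RHS]eq_fun do rewrite mulrDr mulrCA.
have [l1 l2 r1 r2] := And4 (bl _ pm) (bl _ pf) (br _ pm) (br _ pf).
have [lc rc] := conj (L1Z haar c l1) (L1Z haar c r1).
by rewrite (cintD lc l2) (cintD rc r2) !cintZ// tm IH.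
Qed.

(* The set of [h] satisfying [twist a F h] for all polynomials [F] is closed under
   products and conull, so that every element of SU(2) is a product of two of its
   elements. *)
Lemma central_twist a F h : ZL1 mu a -> SU2 h -> pol F -> twist a F h.
Proof.
move=> za sh pF.
have aeT : {ae mu, forall x, SU2 x /\ forall G, pol G -> twist a G (invG x)}.
  have : {ae mu, forall x, forall n s, unpickle n = Some s -> twist a (mono s) (invG x)}.
    apply: ae_foralln => n; case: (unpickle n : option (seq nat)) => [s|].
      have := central_ae_twist za (pol_bdd (pol_mono R s)).
      by apply: filterS => x t _ [<-].
    by apply: filterS (ae_SU2 haar) => x _ s.
  apply: filterS2 (ae_SU2 haar) => x sx t; split => // G.
  apply: (twist_pol za.1 (SU2V sx)) => s; exact: (t (pickle s) _ (pickleK s)).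
have sh' := SU2V sh.
have := ae_mpres (mpres_comp (mpres_mulGl haar sh') (mpres_invG haar)) aeT.
move=> /(filterS2 _)/(_ aeT) H.
have [x [[sx t1] [_ t2]]] : exists x, (SU2 x /\ forall G, pol G -> twist a G (invG x)) /\
    (SU2 (mulG (invG h) (invG x)) /\ forall G, pol G -> twist a G (invG (mulG (invG h) (invG x)))).
  by apply: ae_exists; apply: H => x ? ?; split.
have e : mulG (invG x) (invG (mulG (invG h) (invG x))) = h.
  by rewrite invGM !invGK mulKG.
set k := invG (mulG (invG h) (invG x)) in t2 e.
rewrite /twist -e.
transitivity (cint mu (fun y => a y * F (mulG (invG x) (mulG k y)))).
  by congr cint; apply/funext => y; rewrite mulGA.
rewrite (t2 (fun y => F (mulG (invG x) y)) (pol_mulGl _ pF)).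
transitivity (cint mu (fun y => a y * F (mulG (mulG (invG x) y) k))).
  by congr cint; apply/funext => y; rewrite mulGA.
rewrite (t1 (fun y => F (mulG y k)) (pol_mulGr _ pF)).
by congr cint; apply/funext => y; rewrite mulGA.
Qed.

Definition Ad (h x : X) : X := mulG (mulG h x) (invG h).

Lemma pol_Ad h F : pol F -> pol (fun y => F (Ad h y)).
Proof. by move=> /(pol_mulGr (invG h))/(pol_mulGl h). Qed.

(** The consequence of centrality on which the character computations rest. It tests [a] against
    polynomials only, and it survives multiplication by the trace because the trace is itself
    conjugation invariant. *)
Definition cinv a := L1 mu a /\ forall F h, pol F -> SU2 h ->
  cint mu (fun y => a y * F (Ad h y)) = cint mu (fun y => a y * F y).

Lemma central_cinv a : ZL1 mu a -> cinv a.
Proof.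
move=> za; split=> [|F h pF sh]; first exact: za.1.
rewrite (central_twist za sh (pol_mulGr (invG h) pF)).
by congr cint; apply/funext => y; rewrite mulGK.
Qed.

Lemma re_Ad h x : SU2 h -> (Ad h x).1.1 = x.1.1.
Proof. by move=> sh; rewrite /Ad re_mulG_comm mulKG. Qed.

Lemma SU2_Ad h x : SU2 h -> SU2 x -> SU2 (Ad h x).
Proof. by move=> sh sx; apply: SU2M; [exact: SU2M|exact: SU2V]. Qed.

Definition trG (x : X) : complex R := (x.1.1)%:C%C.

Lemma pol_trG : pol trG. Proof. exact: (pol_coord R 0). Qed.

Lemma cinv_tr a : cinv a -> cinv (fun x => a x * trG x).
Proof.
move=> [la ia]; split=> [|F h pF sh]; first exact: (L1M haar la (pol_bdd pol_trG)).
under eq_fun do rewrite -mulrA.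
under [in RHS]eq_fun do rewrite -mulrA.
rewrite -(ia _ _ (polM pol_trG pF) sh); congr cint; apply/funext => y.
by rewrite /trG re_Ad.
Qed.

End Central.

(** * Chebyshev polynomials of both kinds *)

Section Chebyshev.

(** The pair [(T_n, U_(n-1))] with [U_(-1) = 0]; for [r = cos t] it is
    [(cos (n t), sin (n t) / sin t)], and the recursion is the addition formula. The ring is
    arbitrary because bounds are proved over [R] while the integrands are complex. *)
Fixpoint cheb (A : comNzRingType) (n : nat) (r : A) : A * A :=
  if n is m.+1 then
    let: (t, u) := cheb m r in (r * t - (1 - r ^+ 2) * u, t + r * u)
  else (1, 0).

Lemma chebU_rec (A : comNzRingType) n (r : A) :
  (cheb n.+2 r).2 = 2%:R * r * (cheb n.+1 r).2 - (cheb n r).2.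
Proof. by rewrite /=; case: (cheb n r) => t u /=; ring. Qed.

Lemma chebT_U (A : comNzRingType) n (r : A) :
  2%:R * (cheb n.+2 r).1 = (cheb n.+3 r).2 - (cheb n.+1 r).2.
Proof. by rewrite /=; case: (cheb n r) => t u /=; ring. Qed.

(** The identity [cos^2 + sin^2 = 1] in polynomial form; it yields the bound of [T_n] on [-1, 1]
    algebraically. *)
Lemma cheb_pell (A : comNzRingType) n (r : A) :
  (cheb n r).1 ^+ 2 + (1 - r ^+ 2) * (cheb n r).2 ^+ 2 = 1.
Proof.
elim: n => [|n]; first by rewrite /=; ring.
rewrite /=; case: (cheb n r) => t u /= e.
by rewrite -[RHS]e; ring: e.
Qed.

Lemma rmorph_cheb (A B : comNzRingType) (phi : {rmorphism A -> B}) n r :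
  cheb n (phi r) = (phi (cheb n r).1, phi (cheb n r).2).
Proof.
elim: n => [|n IH] /=; first by rewrite rmorph1 rmorph0.
by rewrite IH; case: (cheb n r) => t u /=; rewrite !(rmorphM, rmorphB, rmorphD, rmorph1, rmorphXn).
Qed.

Lemma chebT_le1 (F : realDomainType) n (r : F) : `|r| <= 1 -> `|(cheb n r).1| <= 1.
Proof.
move=> r1; rewrite -(@ler_pXn2r _ 2) ?nnegrE// expr1n real_normK ?num_real//.
rewrite -[leRHS](cheb_pell n r) lerDl mulr_ge0 ?sqr_ge0// subr_ge0.
by rewrite -real_normK ?num_real// expr_le1.
Qed.

End Chebyshev.

Section PolCheb.
Variable R : realType.
Lemma pol_cheb n (f : SU2car R -> complex R) : pol f ->
  pol (fun x => (cheb n (f x)).1) /\ pol (fun x => (cheb n (f x)).2).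
Proof.
move=> pf; elim: n => [|n [p1 p2]]; first by split; exact: pol_cst.
split.
  apply: (eq_pol _ (polB (polM pf p1) (polM (polB (pol_cst 1) (polX 2 pf)) p2))) => x /=.
  by case: (cheb n (f x)).
apply: (eq_pol _ (polD p1 (polM pf p2))) => x /=.
by case: (cheb n (f x)).
Qed.
End PolCheb.

(** * Characters of the centre *)
Section CentralIntegrals.
Context {R : realType} (mu : probability (SU2car R) R).
Hypothesis haar : is_haar mu.
Local Notation X := (SU2car R).
Implicit Types a f g F G : X -> complex R.

Lemma L1_pol a F : L1 mu a -> pol F -> L1 mu (fun x => a x * F x).
Proof. by move=> la pF; apply: L1M => //; exact: pol_bdd. Qed.

Lemma alpha_of_ab (u v : complex R) : alpha (of_ab u v) = u.
Proof. by case: u. Qed.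
Lemma beta_of_ab (u v : complex R) : beta (of_ab u v) = v.
Proof. by case: v. Qed.
Lemma SU2_of_ab (u v : complex R) : cabs u ^+ 2 + cabs v ^+ 2 = 1 -> SU2 (of_ab u v).
Proof. by rewrite !cabs_sq SU2E /sqnorm /= addrA. Qed.

(** Conjugation by [h] multiplies the integral by [l] and also leaves it unchanged. *)
Lemma cinv_eq0 a F h (l : complex R) : cinv mu a -> pol F -> SU2 h ->
  (forall x, SU2 x -> F (Ad h x) = l * F x) -> l <> 1 ->
  cint mu (fun x => a x * F x) = 0.
Proof.
move=> [la ia] pF sh Fh l1; set I := LHS.
have laF := L1_pol la pF.
have e : I = l * I.
  rewrite /I -{1}(ia F h pF sh) -cintZ//; apply: eq_cint => //.
  - exact/L1_cmeas/L1_pol/(pol_Ad h pF).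
  - exact: L1_cmeas (L1Z haar l laF).
  - by move=> x sx; rewrite Fh// mulrCA.
have /eqP : (1 - l) * I = 0 by rewrite mulrBl mul1r -e subrr.
by rewrite mulf_eq0 subr_eq0 => /orP[/eqP/esym//|/eqP].
Qed.

(** Conjugation by the diagonal matrix with entries [cconj t] and [t] fixes [alpha] and multiplies
    [beta] by [t ^ 2]; [t] is chosen with [t ^ (2 k)] different from 1. *)
Lemma cinv_torus a i k : cinv mu a -> (0 < k)%N ->
  cint mu (fun x => a x * (alpha x ^+ i * beta x ^+ k)) = 0.
Proof.
move=> ca k0; have [t t1 tk] : exists2 t : complex R, cabs t = 1 & t ^+ (2 * k) <> 1.
  by apply: exists_unit_expr_neq1; rewrite muln_gt0.
have tt : cconj t * t = 1 by rewrite mulrC mul_cconj t1 expr1n.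
have st : SU2 (of_ab (cconj t) 0).
  by apply: SU2_of_ab; rewrite cabs_cconj t1 cabs0 expr1n expr0n/= addr0.
apply: (cinv_eq0 (h := of_ab (cconj t) 0) (l := t ^+ (2 * k))) => //.
  exact: polM (polX _ (pol_alpha R)) (polX _ (pol_beta R)).
move=> x sx.
have cc0 : cconj (0 : complex R) = 0 by apply: complex_ext; rewrite /= ?oppr0.
have -> : alpha (Ad (of_ab (cconj t) 0) x) = alpha x.
  rewrite /Ad !(alphaM, betaM) /invG !(alpha_of_ab, beta_of_ab) cconjK cc0.
  by rewrite mul0r subr0 oppr0 mulr0 subr0 mulrAC tt mul1r.
have -> : beta (Ad (of_ab (cconj t) 0) x) = t ^+ 2 * beta x.
  rewrite /Ad !(alphaM, betaM) /invG !(alpha_of_ab, beta_of_ab) cconjK.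
  by rewrite mul0r add0r oppr0 mulr0 addr0 expr2 mulrAC.
by rewrite exprMn -exprM mulrCA.
Qed.

Definition omega m a := cint mu (fun x => a x * alpha x ^+ m).

Lemma omega_le m a : L1 mu a -> cabs (omega m a) <= nrm1 mu a.
Proof.
move=> la; rewrite -[leRHS]mul1r; apply: cint_mul_le => //.
  exact/pol_bdd/polX/pol_alpha.
by move=> x sx; rewrite cabsX exprn_ile1 ?cabs_ge0// cabs_alpha.
Qed.

(** The exponents [i] and [j] are left free for the induction on [n]: each factor split off raises
    one of them, and every term that acquires a power of [beta] vanishes by torus invariance. *)
Lemma cinv_binomial a (c b : complex R) n i j : cinv mu a ->
  cint mu (fun x => a x * (alpha x ^+ i * beta x ^+ j * (c * alpha x - b * beta x) ^+ n)) =
  if j == 0%N then c ^+ n * omega (i + n) a else 0.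
Proof.
move=> ca; have la := ca.1.
elim: n i j => [|n IH] i j.
  under eq_fun do rewrite expr0 mulr1.
  have [->|j0] := eqVneq j 0%N; last by rewrite cinv_torus// lt0n.
  by under eq_fun do rewrite expr0 mulr1; rewrite expr0 mul1r addn0.
pose G i j x := alpha x ^+ i * beta x ^+ j * (c * alpha x - b * beta x) ^+ n : complex R.
have lG i' j' : L1 mu (fun x => a x * G i' j' x).
  apply: L1_pol => //; apply: polM; first apply: polM.
  - exact/polX/pol_alpha.
  - exact/polX/pol_beta.
  - by apply: polX; apply: polB; apply: polZ; [exact: pol_alpha|exact: pol_beta].
transitivity (cint mu (fun x => c * (a x * G i.+1 j x) - b * (a x * G i j.+1 x))).
  by congr cint; apply/funext => x; rewrite /G !exprS; ring.
rewrite (cintB haar (L1Z haar c (lG _ _)) (L1Z haar b (lG _ _))) !cintZ// !IH /= mulr0 subr0.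
case: ifP => _; last by rewrite mulr0.
by rewrite mulrA -exprS addSnnS.
Qed.

Lemma omega_conv f g m : L1 mu f -> cinv mu g ->
  omega m (conv mu f g) = omega m f * omega m g.
Proof.
move=> lf cg; have lg := cg.1.
have pm : pol (fun x : X => alpha x ^+ m) by exact/polX/pol_alpha.
rewrite /omega (cint_conv haar lf lg (pol_bdd pm) (M := fun y => alpha y ^+ m * omega m g)).
- under eq_fun do rewrite mulrA.
  by rewrite cintZr//; exact: L1_pol.
- exact/(pol_bdd (polM pm (pol_cst _))).1.
- move=> y sy; have := cinv_binomial (alpha y) (cconj (beta y)) m 0 0 cg.
  rewrite /= add0n => <-; congr cint; apply/funext => z.
  by rewrite alphaM !expr0 !mul1r.
Qed.

(** A rotation parametrised by its sine, which keeps everything algebraic: differentiation at 0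
    becomes an estimate with error of order [s ^ 2]. *)
Definition rot (s : R) : X := of_ab (Complex (Num.sqrt (1 - s ^+ 2)) 0) (Complex 0 s).

Lemma sqrt_facts (s : R) : 0 <= s <= 1 -> let c := Num.sqrt (1 - s ^+ 2) in
  [/\ c ^+ 2 + s ^+ 2 = 1, 0 <= c <= 1 & 1 - c <= s ^+ 2].
Proof.
move=> /andP[s0 s1] c; have c2 : c ^+ 2 = 1 - s ^+ 2.
  by rewrite sqr_sqrtr// subr_ge0 expr_le1.
have c0 : 0 <= c by exact: sqrtr_ge0.
have c1 : c <= 1 by nra.
by split; [rewrite c2 subrK|rewrite c0 c1|nra].
Qed.

Lemma SU2_rot s : 0 <= s <= 1 -> SU2 (rot s).
Proof.
move=> /sqrt_facts[e _ _]; apply: SU2_of_ab.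
by rewrite !cabs_sq /= expr0n/= addr0 add0r.
Qed.

Lemma rot_coords (s : R) : let c := (Num.sqrt (1 - s ^+ 2))%:C%C in
  [/\ alpha (rot s) = c, beta (rot s) = 'i%C * s%:C%C, cconj c = c,
      cconj 'i%C = - 'i%C :> complex R /\ cconj s%:C%C = s%:C%C &
      ('i : complex R)%C ^+ 2 = -1].
Proof.
by split; try split; apply: complex_ext; rewrite ?expr2 /= ?oppr0//; ring.
Qed.

Lemma alpha_rot (s : R) x : let c := (Num.sqrt (1 - s ^+ 2))%:C%C in
  alpha (Ad (rot s) x) = c ^+ 2 * alpha x + s%:C%C ^+ 2 * cconj (alpha x) +
    'i%C * c * s%:C%C * (beta x + cconj (beta x)).
Proof.
move=> c; have [ea eb ec [ei es] ii] := rot_coords s.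
rewrite /Ad !(alphaM, betaM) /invG ea eb !(alpha_of_ab, beta_of_ab).
rewrite !(cconjD, cconjN, cconj_mul, cconjK) ?ei ?es ec -/c.
by ring: ii.
Qed.

Lemma beta_rot (s : R) x : let c := (Num.sqrt (1 - s ^+ 2))%:C%C in
  beta (Ad (rot s) x) = c ^+ 2 * beta x - s%:C%C ^+ 2 * cconj (beta x) +
    'i%C * c * s%:C%C * (alpha x - cconj (alpha x)).
Proof.
move=> c; have [ea eb ec [ei es] ii] := rot_coords s.
rewrite /Ad !(alphaM, betaM) /invG ea eb !(alpha_of_ab, beta_of_ab).
rewrite !(cconjD, cconjN, cconj_mul, cconjK) ?ei ?es ec -/c.
by ring: ii.
Qed.

(* [F'] is the derivative of [F] along the rotations [Ad (rot s)] at [s = 0]. *)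
Definition der F F' := exists C : R, forall (s : R) x, 0 <= s <= 1 -> SU2 x ->
  cabs (F (Ad (rot s) x) - F x - s%:C%C * F' x) <= C * s ^+ 2.

Lemma derM F F' G G' : bddSU2 F -> bddSU2 F' -> bddSU2 G -> bddSU2 G' ->
  der F F' -> der G G' -> der (fun x => F x * G x) (fun x => F' x * G x + F x * G' x).
Proof.
move=> [_ [A FA]] [_ [A' FA']] [_ [B GB]] [_ [B' GB']] [C1 d1] [C2 d2].
(* The product error splits into the error of [F] times [G], the first-order part of [F] (at most
   [A + A'] as [s <= 1]) times the error of [G], and [s ^ 2] times [F' * G']. *)
exists (C1 * B + (A + A') * C2 + A' * B') => s x s01 sx.
have sr : SU2 (Ad (rot s) x) by apply: SU2_Ad => //; exact: SU2_rot.
have [s0 s1] := andP s01.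
move: (d1 s x s01 sx) (d2 s x s01 sx) (FA x sx) (FA' x sx) (GB' x sx) (GB _ sr).
set F1 := F _; set G1 := G (Ad _ _); set e1 := F1 - _ - _; set e2 := G1 - _ - _.
move=> h1 h2 hF hF' hG' hG1.
have -> : F1 * G1 - F x * G x - s%:C%C * (F' x * G x + F x * G' x) =
    e1 * G1 + (F x + s%:C%C * F' x) * e2 + s%:C%C ^+ 2 * (F' x * G' x).
  by rewrite /e1 /e2; ring.
have cs : cabs (s%:C%C) = s by rewrite cabs_real ger0_norm.
apply: (le_trans (cabsD _ _)); apply: (le_trans (lerD (cabsD _ _) (lexx _))).
rewrite !(cabsX, cabsM) cs !mulrDl; apply: lerD; first apply: lerD.
- by rewrite mulrAC ler_pM ?cabs_ge0.
- rewrite -!mulrDl -mulrA; apply: ler_pM; rewrite ?cabs_ge0//.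
  apply: (le_trans (cabsD _ _)); rewrite lerD// cabsM cs.
  by rewrite -[leRHS]mul1r ler_pM ?cabs_ge0.
- by rewrite mulrC ler_wpM2r ?sqr_ge0// ler_pM ?cabs_ge0.
Qed.

Lemma der_exp F F' n : bddSU2 F -> bddSU2 F' -> der F F' ->
  der (fun x => F x ^+ n.+1) (fun x => n.+1%:R * (F x ^+ n * F' x)).
Proof.
move=> bF bF' dF; elim: n => [|n IH].
  under eq_fun do rewrite expr1.
  by under [X in der _ X]eq_fun do rewrite expr0 !mul1r.
under eq_fun do rewrite exprS.
have -> : (fun x => n.+2%:R * (F x ^+ n.+1 * F' x)) =
    (fun x => F' x * F x ^+ n.+1 + F x * (n.+1%:R * (F x ^+ n * F' x))).
  by apply/funext => x; rewrite exprS -[n.+2]addn1 natrD; ring.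
apply: derM => //; first exact: bddX.
by apply: bddM; [exact: bdd_cst|apply: bddM => //; exact: bddX].
Qed.

(** This is what the exact formulas for rotated [alpha] and [beta] leave after their linear part,
    once [c ^ 2 = 1 - s ^ 2] is inserted. Each of the two terms is at most [2 * s ^ 2], whence the
    constant 4. *)
Lemma der_remainder (s c : R) (u v : complex R) : 0 <= s <= 1 -> 0 <= c <= 1 ->
  1 - c <= s ^+ 2 -> cabs u <= 2 -> cabs v <= 2 ->
  cabs (s%:C%C ^+ 2 * u + 'i%C * (c - 1)%:C%C * s%:C%C * v) <= 4 * s ^+ 2.
Proof.
move=> /andP[s0 s1] /andP[c0 c1] cs hu hv.
apply: (le_trans (cabsD _ _)); rewrite !(cabsX, cabsM) !cabs_real.
have -> : cabs ('i%C : complex R) = 1.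
  by rewrite /cabs /= expr0n/= expr1n add0r sqrtr1.
rewrite mul1r (ger0_norm s0) ler0_norm ?subr_le0// opprB.
have -> : 4 * s ^+ 2 = s ^+ 2 * 2 + s ^+ 2 * 2 :> R by ring.
apply: lerD; first by rewrite ler_wpM2l ?sqr_ge0.
apply: ler_pM; rewrite ?cabs_ge0 ?mulr_ge0// ?subr_ge0//.
by rewrite -[leRHS]mulr1 ler_pM// subr_ge0.
Qed.

Lemma cabs_pm2 (u v : complex R) : cabs u <= 1 -> cabs v <= 1 ->
  cabs (u + v) <= 2 /\ cabs (u - v) <= 2.
Proof.
move=> hu hv; have -> : (2 : R) = 1 + 1 by ring.
by split; [apply: (le_trans (cabsD _ _))|apply: (le_trans (cabsB _ _))]; exact: lerD.
Qed.

Lemma der_alpha : der (@alpha R) (fun x => 'i%C * (beta x + cconj (beta x))).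
Proof.
exists 4 => s x s01 sx; have [e c01 cs] := sqrt_facts s01.
rewrite alpha_rot; move: (Num.sqrt _) e c01 cs => c e c01 cs.
have eC : c%:C%C ^+ 2 = 1 - s%:C%C ^+ 2 :> complex R.
  by rewrite -!rmorphXn/= -[1]/(1%:C%C) -rmorphB/= -e addrK.
have [_ ha] := cabs_pm2 (v := alpha x) (eq_ind_r (fun t => t <= 1) (cabs_alpha sx) (cabs_cconj (alpha x))) (cabs_alpha sx).
have [hb _] := cabs_pm2 (v := cconj (beta x)) (cabs_beta sx) (eq_ind_r (fun t => t <= 1) (cabs_beta sx) (cabs_cconj (beta x))).
apply: le_trans (der_remainder s01 c01 cs ha hb).
by rewrite le_eqVlt; apply/orP; left; apply/eqP; congr cabs; rewrite eC rmorphB rmorph1; ring.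
Qed.

Lemma der_beta : der (@beta R) (fun x => 'i%C * (alpha x - cconj (alpha x))).
Proof.
exists 4 => s x s01 sx; have [e c01 cs] := sqrt_facts s01.
rewrite beta_rot; move: (Num.sqrt _) e c01 cs => c e c01 cs.
have eC : c%:C%C ^+ 2 = 1 - s%:C%C ^+ 2 :> complex R.
  by rewrite -!rmorphXn/= -[1]/(1%:C%C) -rmorphB/= -e addrK.
have [_ ha] := cabs_pm2 (u := alpha x) (v := cconj (alpha x)) (cabs_alpha sx) (eq_ind_r (fun t => t <= 1) (cabs_alpha sx) (cabs_cconj (alpha x))).
have [hb _] := cabs_pm2 (v := cconj (beta x)) (cabs_beta sx) (eq_ind_r (fun t => t <= 1) (cabs_beta sx) (cabs_cconj (beta x))).
rewrite -cabsN in hb.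
apply: le_trans (der_remainder s01 c01 cs hb ha).
by rewrite le_eqVlt; apply/orP; left; apply/eqP; congr cabs; rewrite eC rmorphB rmorph1; ring.
Qed.

(** The integral of [F] against [a] is constant along the rotations, so [s] times the integral of
    [F'] is of order [s ^ 2]; dividing by [s] leaves a bound [K * s] for every [s] in (0, 1]. *)
Lemma cinv_der a F F' : cinv mu a -> pol F -> pol F' -> der F F' ->
  cint mu (fun x => a x * F' x) = 0.
Proof.
move=> [la ia] pF pF' [C dF]; apply: cabs_eq0; set I := cabs _.
pose K := C * nrm1 mu a.
have IK (s : R) : 0 < s <= 1 -> I <= K * s.
  move=> /andP[s0 s1]; have s01 : 0 <= s <= 1 by rewrite ltW.
  have pA := pol_Ad (rot s) pF.
  have pD := polB (polB pA pF) (polZ s%:C%C pF').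
  have := @cint_mul_le _ mu haar a _ (C * s ^+ 2) la (pol_bdd pD) (fun x sx => dF s x s01 sx).
  under eq_fun do rewrite !mulrBr (mulrCA _ s%:C%C).
  rewrite !cintB ?cintZ//; try exact: L1_pol; last 2 first.
  - by apply: L1B => //; exact: L1_pol.
  - by apply: L1Z => //; exact: L1_pol.
  rewrite ia//; last exact: SU2_rot.
  rewrite subrr sub0r cabsN cabsM cabs_real gtr0_norm// -/I.
  have -> : C * s ^+ 2 * nrm1 mu a = s * (K * s) by rewrite /K; ring.
  by rewrite ler_pM2l.
apply/eqP; rewrite eq_le cabs_ge0 andbT leNgt; apply/negP => I0.
have I1 := IK 1; have K0 : 0 < K.
  by rewrite (lt_le_trans I0)// (le_trans (I1 _))// ?mulr1// ltr01 lexx.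
have IleK : I <= K by rewrite (le_trans (I1 _))// ?mulr1// ltr01 lexx.
clearbody I K.
(* The choice [s = I / (2 * K)] turns [I <= K * s] into [I <= I / 2]; it is at most 1 since
   [I <= K]. *)
have s0 : 0 < I / (2 * K) by rewrite divr_gt0// mulr_gt0.
have s1 : I / (2 * K) <= 1 by rewrite ler_pdivrMr ?mulr_gt0//; lra.
have := IK _ (introT andP (conj s0 s1)).
have -> : K * (I / (2 * K)) = I / 2 by field; rewrite gt_eqF.
by lra.
Qed.

Lemma SU2_alpha_beta (x : X) : SU2 x -> beta x * cconj (beta x) = 1 - alpha x * cconj (alpha x).
Proof.
by move=> /SU2_sq e; rewrite !mul_cconj -[1]/(1%:C%C) -rmorphB/= -e addrAC subrr add0r.
Qed.

Lemma cconj_alpha (x : X) : cconj (alpha x) = 2%:R * trG x - alpha x.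
Proof. by apply: complex_ext; rewrite ?(reD, imD, reN, imN, reM, imM)/=; ring. Qed.

(* The derivative of [alpha ^+ n.+1 * beta] along [Ad (rot s)], integrated against [a];
   the term in [beta ^+ 2] it produces vanishes by torus invariance. *)
Lemma omega_rec a n : cinv mu a ->
  n.+3%:R * omega n.+2 a =
  2%:R * n.+2%:R * omega n.+1 (fun x => a x * trG x) - n.+1%:R * omega n a.
Proof.
move=> ca; have la := ca.1.
have [pa pb pac pbc] := And4 (pol_alpha R) (pol_beta R) (pol_alphaJ R) (pol_betaJ R).
have pi1 : pol (fun x : X => 'i%C * (beta x + cconj (beta x))) by exact: polZ (polD pb pbc).
have pi2 : pol (fun x : X => 'i%C * (alpha x - cconj (alpha x))) by exact: polZ (polB pa pac).
have pd := polZ n.+1%:R (polM (polX n pa) pi1).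
have d := derM (pol_bdd (polX n.+1 pa)) (pol_bdd pd) (pol_bdd pb) (pol_bdd pi2)
  (der_exp n (pol_bdd pa) (pol_bdd pi1) der_alpha) der_beta.
have p' := polD (polM pd pb) (polM (polX n.+1 pa) pi2).
have := cinv_der ca (polM (polX n.+1 pa) pb) p' d.
have l1 := L1_pol la (polM (polX n pa) (polX 2 pb)).
have l2 := L1_pol la (polX n pa).
have l3 := L1_pol (cinv_tr haar ca).1 (polX n.+1 pa).
have l4 := L1_pol la (polX n.+2 pa).
have z1 := L1Z haar n.+1%:R l1.
have z2 := L1Z haar n.+1%:R l2.
have z3 := L1Z haar (2%:R * n.+2%:R) l3.
have z4 := L1Z haar n.+3%:R l4.
have l23 := L1B haar z2 z3.
have l234 := L1D l23 z4.
have l1234 := L1D z1 l234.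
rewrite (@eq_cint _ mu haar _ _ _ (L1_cmeas (L1Z haar 'i%C l1234))); last 2 first.
- exact: (L1_cmeas (L1_pol la p')).
- move=> x sx.
  (* Put [r = trG x]. Replacing [|beta|^2] by [1 - |alpha|^2] and the conjugate of [alpha] by
     [2 r - alpha], the derivative is [i] times [(n+1) alpha^n beta^2 + (n+1) alpha^n - 2 (n+2) r
     alpha^(n+1) + (n+3) alpha^(n+2)]. *)
  have e := SU2_alpha_beta sx; rewrite cconj_alpha in e *.
  have -> : n.+3%:R = n.+1%:R + 2%:R :> complex R by rewrite -natrD addn2.
  have -> : n.+2%:R = n.+1%:R + 1 :> complex R by rewrite -natr1.
  rewrite !(exprS (alpha x)); move: (alpha x ^+ n) (n.+1%:R) => P N.
  by ring: e.
rewrite cintZ// cintD// cintD// cintB// !cintZ// cinv_torus// mulr0 add0r -!/(omega _ _) => /eqP.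
rewrite mulf_eq0 => /orP[/eqP/(congr1 (@im R))/eqP|/eqP]; first by rewrite /= oner_eq0.
by move=> e; rewrite -[LHS]subr0 -e; ring.
Qed.

(** Both sides satisfy the recurrence [U_(n+2) = 2 r U_(n+1) - U_n], the right one by [omega_rec].
    The function [a] varies in the induction because the factor [r] is absorbed into it. *)
Lemma cint_chebU a n : cinv mu a ->
  cint mu (fun x => a x * (cheb n.+1 (trG x)).2) = n.+1%:R * omega n a.
Proof.
elim/ltn_ind: n a => -[|[|n]] IH a ca; have la := ca.1.
- rewrite mul1r; congr cint; apply/funext => x /=.
  by rewrite mulr0 addr0.
- have pac := pol_alphaJ R.
  transitivity (cint mu (fun x => a x * (alpha x + cconj (alpha x)))).
    by congr cint; apply/funext => x /=; rewrite cconj_alpha; ring.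
  (* Conjugation by the quaternion [j] exchanges [alpha] and its conjugate. *)
  have sj : SU2 (of_ab (0 : complex R) 1) by apply: SU2_of_ab; rewrite cabs0 cabs1; ring.
  have pa := pol_alpha R; have [l1 l2] := conj (L1_pol la pa) (L1_pol la pac).
  under eq_fun do rewrite mulrDr.
  rewrite cintD// -(ca.2 _ _ pac sj) /omega.
  have -> : (fun y => a y * cconj (alpha (Ad (of_ab 0 1) y))) = (fun y => a y * alpha y).
    apply/funext => y; congr (_ * _).
    rewrite /Ad !(alphaM, betaM) /invG !(alpha_of_ab, beta_of_ab).
    have -> : cconj (0 : complex R) = 0 by apply: complex_ext; rewrite /= ?oppr0.
    have -> : cconj (1 : complex R) = 1 by apply: complex_ext; rewrite /= ?oppr0.
    by rewrite !(mul0r, mulr0, mul1r, add0r, addr0, mulrN1, opprK, cconjK).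
  by under [in RHS]eq_fun do rewrite expr1; rewrite mulr_natl mulr2n.
- have ct := cinv_tr haar ca.
  rewrite omega_rec// -mulrA -[n.+2%:R * _]IH// -IH//.
  have [_ p1] := pol_cheb n.+2 (@pol_trG R); have [_ p2] := pol_cheb n.+1 (@pol_trG R).
  have [l1 l2] := conj (L1_pol ct.1 p1) (L1_pol la p2).
  rewrite -cintZ// -cintB//; last exact: L1Z.
  congr cint; apply/funext => x; rewrite chebU_rec; ring.
Qed.

Lemma cint_chebT a n : cinv mu a ->
  2%:R * cint mu (fun x => a x * (cheb n.+2 (trG x)).1) =
  n.+3%:R * omega n.+2 a - n.+1%:R * omega n a.
Proof.
move=> ca; have la := ca.1.
have [p0 _] := pol_cheb n.+2 (@pol_trG R).
have [_ p1] := pol_cheb n.+3 (@pol_trG R); have [_ p2] := pol_cheb n.+1 (@pol_trG R).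
rewrite -(cint_chebU n.+2 ca) -(cint_chebU n ca) -(cintZ _ (L1_pol la p0)).
rewrite -(cintB haar (L1_pol la p1) (L1_pol la p2)).
congr cint; apply/funext => x; rewrite mulrCA chebT_U; ring.
Qed.

Lemma cabs_chebT n (x : X) : SU2 x -> cabs (cheb n (trG x)).1 <= 1.
Proof.
move=> sx; rewrite /trG (rmorph_cheb (real_complex R)) /= cabs_real chebT_le1//.
exact: le_trans (re_le_cabs (alpha x)) (cabs_alpha sx).
Qed.

End CentralIntegrals.

(** * Class functions and test elements of the centre *)

Section ClassFunctions.
Context {R : realType} (mu : probability (SU2car R) R).
Hypothesis haar : is_haar mu.
Local Notation X := (SU2car R).
Implicit Types a b f g : X -> complex R.

Lemma mpres_mulV (x : X) : SU2 x -> mpres mu (fun z => mulG x (invG z)).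
Proof. by move=> sx; exact: (mpres_comp (mpres_mulGl haar sx) (mpres_invG haar)). Qed.

Lemma conv_swap f g (x : X) : cmeas f -> cmeas g -> SU2 x ->
  conv mu f g x = cint mu (fun z => g z * f (mulG x (invG z))).
Proof.
move=> mf mg sx; have p := mpres_mulV sx.
have mK : cmeas (fun y => f y * g (mulG (invG y) x)).
  apply: cmeasM => //; apply: (cmeas_comp _ mg).
  by apply: measurable_mulG; [exact: measurable_invG|exact: measurable_cst].
rewrite /conv -(cint_mpres p mK); congr cint; apply/funext => z.
by rewrite invGM invGK mulGVK// mulrC.
Qed.

Lemma class_conv_comm f g (x : X) : cmeas f -> cmeas g ->
  (forall y z, SU2 y -> SU2 z -> f (mulG y z) = f (mulG z y)) ->
  SU2 x -> conv mu f g x = conv mu g f x.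
Proof.
move=> mf mg cf sx; rewrite conv_swap//; apply: eq_cint => //.
- by apply: cmeasM => //; exact: (cmeas_comp (mpres_mulV sx).1 mf).
- apply: cmeasM => //; apply: (cmeas_comp _ mf).
  by apply: measurable_mulG; [exact: measurable_invG|exact: measurable_cst].
- by move=> z sz; rewrite cf//; exact: SU2V.
Qed.

Lemma class_ZL1 f : L1 mu f ->
  (forall y z, SU2 y -> SU2 z -> f (mulG y z) = f (mulG z y)) -> ZL1 mu f.
Proof.
move=> lf cf; split => // g lg; have := ae_SU2 haar; apply: filterS => x sx.
exact: (class_conv_comm (L1_cmeas lf) (L1_cmeas lg) cf sx).
Qed.

Definition pclass f := pol f /\ forall y z, f (mulG y z) = f (mulG z y).

Lemma pclass_trX n : pclass (fun x => trG x ^+ n).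
Proof.
split; first exact/polX/pol_trG.
by move=> y z; rewrite /trG re_mulG_comm.
Qed.

Lemma pclass_ZL1 f : pclass f -> ZL1 mu f.
Proof. by move=> [pf cf]; apply: class_ZL1 => [|y z _ _]; [exact: (L1_bdd haar (pol_bdd pf))|exact: cf]. Qed.

(** In the integral of [b z * f (x y z^-1)], invariance of [b] replaces [z] by [x z x^-1]; cyclicity
    of [f] then cancels [x] and leaves [f (y x z^-1)]. *)
Lemma conv_pclass f b (x y : X) : pclass f -> cinv mu b -> SU2 x -> SU2 y ->
  conv mu f b (mulG x y) = conv mu f b (mulG y x).
Proof.
move=> [pf cf] [lb ib] sx sy; have [mf mb] := conj (pol_bdd pf).1 (L1_cmeas lb).
rewrite !conv_swap//; try exact: SU2M.
rewrite -(ib _ x (pol_invG (pol_mulGl (mulG x y) pf)) sx); congr cint.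
apply/funext => z; congr (_ * _).
by rewrite /Ad !invGM invGK cf !mulGA mulGVK// cf mulGA.
Qed.

(** Keeps the module action inside tensors over the centre: convolution with [f] produces a class
    function at every point of SU(2), not only almost everywhere. *)
Lemma ZL1_conv_l f b : pclass f -> ZL1 mu b -> ZL1 mu (conv mu f b).
Proof.
move=> cf zb; apply: class_ZL1.
  by apply: L1_conv => //; [exact: (pclass_ZL1 cf).1|exact: zb.1].
by move=> y z sy sz; apply: conv_pclass => //; exact: central_cinv.
Qed.

Lemma ZL1_conv_r f b : pclass f -> ZL1 mu b -> ZL1 mu (conv mu b f).
Proof.
move=> cf zb; have lf := (pclass_ZL1 cf).1; have lb := zb.1.
apply: class_ZL1; first exact: L1_conv.
have e x : SU2 x -> conv mu b f x = conv mu f b x.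
  move=> sx; apply/esym/class_conv_comm => //; [exact: (L1_cmeas lf)|exact: (L1_cmeas lb)|].
  by move=> y z _ _; exact: cf.2.
move=> y z sy sz; rewrite !e; try exact: SU2M.
by apply: conv_pclass => //; exact: central_cinv.
Qed.

Lemma cint_translate_eq0 f (h : X) (l : complex R) : L1 mu f -> SU2 h ->
  (forall x, SU2 x -> f (mulG h x) = l * f x) -> l <> 1 -> cint mu f = 0.
Proof.
move=> lf sh fh l1; have p := mpres_mulGl haar sh.
have e : cint mu f = l * cint mu f.
  rewrite -{1}(cint_mpres p (L1_cmeas lf)) -cintZ//; apply: eq_cint => //.
    exact: (L1_cmeas (L1_mpres p lf)).
  exact: (L1_cmeas (L1Z haar l lf)).
have /eqP : (1 - l) * cint mu f = 0 by rewrite mulrBl mul1r -e subrr.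
by rewrite mulf_eq0 subr_eq0 => /orP[/eqP/esym//|/eqP].
Qed.

Let apol i j : pol (fun x : X => alpha x ^+ i * cconj (alpha x) ^+ j).
Proof. exact: (polM (polX i (pol_alpha R)) (polX j (pol_alphaJ R))). Qed.

(** Left translation by the diagonal matrix with entries [t] and [cconj t] multiplies the integrand
    by [t ^ (i - j)]. *)
Lemma cint_alpha_unbalanced i j : (j < i)%N ->
  cint mu (fun x => alpha x ^+ i * cconj (alpha x) ^+ j) = 0.
Proof.
move=> ji; have [t t1 ti] : exists2 t : complex R, cabs t = 1 & t ^+ (i - j) <> 1.
  by apply: exists_unit_expr_neq1; rewrite subn_gt0.
have st : SU2 (of_ab t 0).
  by apply: SU2_of_ab; rewrite t1 cabs0 expr1n expr0n/= addr0.
apply: (cint_translate_eq0 (h := of_ab t 0) (l := t ^+ (i - j))) => //.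
  exact: (L1_bdd haar (pol_bdd (apol i j))).
move=> x sx; have cc0 : cconj (0 : complex R) = 0 by apply: complex_ext; rewrite /= ?oppr0.
rewrite alphaM alpha_of_ab beta_of_ab cc0 mul0r subr0 cconj_mul !exprMn mulrACA.
congr (_ * _); rewrite -{1}(subnK (ltnW ji)) exprD -mulrA -exprMn.
by rewrite mul_cconj t1 expr1n expr1n mulr1.
Qed.

Lemma trG_half (x : X) : trG x = 2^-1 * (alpha x + cconj (alpha x)).
Proof.
by rewrite cconj_alpha addrC subrK mulrA mulVf ?mul1r// pnatr_eq0.
Qed.

Lemma cint_trX_rec m i j :
  cint mu (fun x => trG x ^+ m.+1 * (alpha x ^+ i * cconj (alpha x) ^+ j)) =
  2^-1 * (cint mu (fun x => trG x ^+ m * (alpha x ^+ i.+1 * cconj (alpha x) ^+ j)) +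
          cint mu (fun x => trG x ^+ m * (alpha x ^+ i * cconj (alpha x) ^+ j.+1))).
Proof.
have l k l : L1 mu (fun x => trG x ^+ m * (alpha x ^+ k * cconj (alpha x) ^+ l)).
  exact: (L1_bdd haar (pol_bdd (polM (polX m pol_trG) (apol k l)))).
rewrite -cintD// -cintZ; last exact: L1D.
congr cint; apply/funext => x; rewrite [trG x ^+ _]exprS trG_half !exprS; ring.
Qed.

(** With the trace expanded as half the sum of [alpha] and its conjugate, [m] factors cannot raise
    the exponent [j] of the conjugate up to [i], so every term is unbalanced. *)
Lemma cint_trX_small m i j : (m + j < i)%N ->
  cint mu (fun x => trG x ^+ m * (alpha x ^+ i * cconj (alpha x) ^+ j)) = 0.
Proof.
elim: m i j => [|m IH] i j h.
  by under eq_fun do rewrite expr0 mul1r; exact: cint_alpha_unbalanced.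
by rewrite cint_trX_rec !IH ?addr0 ?mulr0// ?addnS -?addSn// ltnW// ltnW.
Qed.

(** Only the term that takes the conjugate from all [m] factors is balanced, and it carries the
    coefficient [2^-m]. *)
Lemma cint_trX_diag m j :
  cint mu (fun x => trG x ^+ m * (alpha x ^+ (m + j) * cconj (alpha x) ^+ j)) =
  2^-1 ^+ m * cint mu (fun x => alpha x ^+ (m + j) * cconj (alpha x) ^+ (m + j)).
Proof.
elim: m j => [|m IH] j.
  by rewrite mul1r add0n; under eq_fun do rewrite expr0 mul1r.
rewrite cint_trX_rec cint_trX_small ?add0r; last by rewrite !addSn.
by rewrite addSnnS IH mulrA -exprS.
Qed.

Lemma nrm1_1 : nrm1 mu (fun=> 1) = 1.
Proof.
rewrite /nrm1; under eq_Rintegral do rewrite cabs1.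
by rewrite Rintegral_cst// mul1r [X in fine X](probability_setT mu).
Qed.

Lemma cint_cst c : cint mu (fun=> c) = c.
Proof.
by rewrite /cint !Rintegral_cst// [X in fine X](probability_setT mu) !mulr1; case: c.
Qed.

Lemma sum_pow_ge (p q : R) n : 0 <= p -> 0 <= q -> p + q = 1 ->
  2^-1 ^+ n <= p ^+ n + q ^+ n <= 2.
Proof.
move=> p0 q0 pq; apply/andP; split; last first.
  have -> : (2 : R) = 1 + 1 by ring.
  by apply: lerD; apply: exprn_ile1; lra.
have [h|h] := leP 2^-1 p.
  have := @lerXn2r R n 2^-1 p; rewrite !nnegrE invr_ge0 ler0n p0 h => /(_ isT isT isT).
  by move=> /le_trans; apply; rewrite lerDl exprn_ge0.
have {}h : 2^-1 <= q by lra.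
have := @lerXn2r R n 2^-1 q; rewrite !nnegrE invr_ge0 ler0n q0 h => /(_ isT isT isT).
by move=> /le_trans; apply; rewrite lerDr exprn_ge0.
Qed.

(* On SU(2), [|alpha|^(2n) + |beta|^(2n) >= 2^-n], and the two terms have the same
   integral. *)
Lemma cint_alpha_balanced n : cint mu (fun x => alpha x ^+ n * cconj (alpha x) ^+ n) <> 0.
Proof.
move=> I0.
have pb : pol (fun x : X => beta x ^+ n * cconj (beta x) ^+ n).
  exact: (polM (polX n (pol_beta R)) (polX n (pol_betaJ R))).
have la := L1_bdd haar (pol_bdd (apol n n)); have lb := L1_bdd haar (pol_bdd pb).
have J0 : cint mu (fun x => beta x ^+ n * cconj (beta x) ^+ n) = 0.
  have sj : SU2 (of_ab (0 : complex R) 1).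
    by apply: SU2_of_ab; rewrite cabs0 cabs1; ring.
  rewrite -I0 -(cint_mpres (mpres_mulGl haar sj) (L1_cmeas la)).
  congr cint; apply/funext => x; rewrite alphaM alpha_of_ab beta_of_ab.
  have -> : cconj (1 : complex R) = 1 by apply: complex_ext; rewrite /= ?oppr0.
  by rewrite mul0r sub0r mul1r cconjN -!exprMn mulrNN.
(* If both integrals vanish, [G] has integral 1, against its bound [1 - 2^-(n+1)]. The factor 1/2
   makes [G] nonnegative on SU(2), the sum being at most 2. *)
pose G (x : X) := 1 - 2^-1 * (alpha x ^+ n * cconj (alpha x) ^+ n +
                              beta x ^+ n * cconj (beta x) ^+ n).
have pG : pol G by exact: (polB (pol_cst 1) (polZ _ (polD (apol n n) pb))).
have GE x : SU2 x -> cabs (G x) <= 1 - 2^-1 * 2^-1 ^+ n.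
  move=> sx; rewrite /G -!exprMn !mul_cconj -!rmorphXn/= -rmorphD/=.
  have -> : (2^-1 : complex R) = (2^-1 : R)%:C%C by rewrite fmorphV rmorph_nat.
  rewrite -rmorphM/= -[1]/(1%:C%C) -rmorphB/= cabs_real.
  have /andP[h1 h2] := sum_pow_ge n (sqr_ge0 (cabs (alpha x))) (sqr_ge0 (cabs (beta x))) (SU2_sq sx).
  by rewrite ger0_norm; lra.
have := cint_mul_le haar (L1_bdd haar (bdd_cst 1)) (pol_bdd pG) GE.
under eq_fun do rewrite mul1r.
rewrite nrm1_1 mulr1 /G (cintB haar (L1_bdd haar (bdd_cst 1)) (L1Z haar _ (L1D la lb))).
rewrite cintZ ?cintD//; last exact: L1D.
rewrite I0 J0 cint_cst addr0 mulr0 subr0 cabs1.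
have : 0 < 2^-1 ^+ n :> R by rewrite exprn_gt0// invr_gt0.
by lra.
Qed.

(** Together with [omega_trX_neq0] this makes the powers of the trace triangular with respect to the
    characters. *)
Lemma omega_trX_small m n : (m < n)%N -> omega mu n (fun x => trG x ^+ m) = 0.
Proof.
move=> mn; have := @cint_trX_small m n 0; rewrite addn0 => /(_ mn) <-.
by congr cint; apply/funext => x; rewrite expr0 mulr1.
Qed.

Lemma omega_trX_neq0 n : omega mu n (fun x => trG x ^+ n) <> 0.
Proof.
have := cint_trX_diag n 0; rewrite addn0.
under eq_fun do rewrite expr0 mulr1.
rewrite /omega => -> /eqP; rewrite mulf_eq0 expf_eq0 invr_eq0 pnatr_eq0 andbF /=.
by move/eqP; exact: cint_alpha_balanced.
Qed.

End ClassFunctions.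

(** * Limits and series of complex numbers, taken componentwise *)

Section ComplexLimits.
Variable R : realType.
Implicit Types (v : nat -> complex R) (z : complex R) (x : nat -> R).

Definition cvgC v z := (fun n => re (v n)) @ \oo --> re z /\
                       (fun n => im (v n)) @ \oo --> im z.

Lemma cvgC_unique v z z' : cvgC v z -> cvgC v z' -> z = z'.
Proof.
by move=> [r i] [r' i']; apply: complex_ext; [exact: (cvg_unique _ r r')|exact: (cvg_unique _ i i')].
Qed.
Lemma cvgC_cst z : cvgC (fun=> z) z.
Proof. by split; exact: cvg_cst. Qed.
Lemma cvgCD v v' z z' : cvgC v z -> cvgC v' z' -> cvgC (fun n => v n + v' n) (z + z').
Proof.
move=> [r i] [r' i']; split.
  by rewrite reD; under eq_fun do rewrite reD; exact: cvgD.
by rewrite imD; under eq_fun do rewrite imD; exact: cvgD.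
Qed.
Lemma cvgCZ c v z : cvgC v z -> cvgC (fun n => c * v n) (c * z).
Proof.
move=> [r i]; split.
  by rewrite reM; under eq_fun do rewrite reM; apply: cvgB; exact: cvgMr.
by rewrite imM; under eq_fun do rewrite imM; apply: cvgD; exact: cvgMr.
Qed.
Lemma cvgCB v v' z z' : cvgC v z -> cvgC v' z' -> cvgC (fun n => v n - v' n) (z - z').
Proof.
move=> h h'; have := cvgCD h (cvgCZ (-1) h').
by rewrite mulN1r; under eq_fun do rewrite mulN1r.
Qed.

(** The factor 2 is the price of bounding real and imaginary parts separately; it propagates to the
    estimates on tensors. *)
Lemma cvgC_le v z x (l : R) : cvgC v z -> (forall n, cabs (v n) <= x n) ->
  x @ \oo --> l -> cabs z <= 2 * l.
Proof.
move=> [r i] vx xl.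
have aux (y : nat -> R) (t : R) : y @ \oo --> t -> (forall n, `|y n| <= cabs (v n)) -> `|t| <= l.
  move=> yt yv; have yt' : `|y n| @[n --> \oo] --> `|t| by exact: cvg_norm yt.
  rewrite -(cvg_lim _ yt')// -(cvg_lim _ xl)//; apply: ler_lim.
  - by apply/cvg_ex; exists `|t|.
  - by apply/cvg_ex; exists l.
  - by apply: nearW => n; exact: le_trans (yv n) (vx n).
have h1 := aux _ _ r (fun n => re_le_cabs (v n)).
have h2 := aux _ _ i (fun n => im_le_cabs (v n)).
by rewrite (le_trans (cabs_le z))// mulr_natl mulr2n lerD.
Qed.

Lemma cvgC_csum v x : (forall i, cabs (v i) <= x i) -> cvgn (series x) ->
  cvgC (fun n => \sum_(0 <= i < n) v i) (csum v) /\ cabs (csum v) <= 2 * limn (series x).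
Proof.
move=> vx cx; have x0 i : 0 <= x i by rewrite (le_trans (cabs_ge0 (v i))).
have aux (y : nat -> R) : (forall i, `|y i| <= cabs (v i)) -> cvgn (series y).
  move=> yv; apply: normed_cvg; apply: (series_le_cvg _ x0 _ cx) => i; first exact: normr_ge0.
  exact: (le_trans (yv i) (vx i)).
have c : cvgC (fun n => \sum_(0 <= i < n) v i) (csum v).
  split.
    by under eq_fun do rewrite re_sum; exact: (aux _ (fun i => re_le_cabs (v i))).
  by under eq_fun do rewrite im_sum; exact: (aux _ (fun i => im_le_cabs (v i))).
split => //; apply: (cvgC_le (x := series x) c) => // n.
rewrite /series/=; elim: n => [|n IH]; first by rewrite !big_nil cabs0.
by rewrite !big_nat_recr//= (le_trans (cabsD _ _))// lerD.
Qed.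

End ComplexLimits.

(** * Projective tensors *)
Section Tensors.
Context {R : realType} (mu : probability (SU2car R) R).
Hypothesis haar : is_haar mu.
Local Notation X := (SU2car R).
Local Notation fn := (X -> complex R).
Implicit Types (u v : tensor R) (a b k l : fn) (phi : fn -> fn -> complex R).

Definition wt u i := nrm1 mu (u i).1 * nrm1 mu (u i).2.

Lemma pairing_cvg phi u : bilin_form1 mu phi -> valid_tensor mu u ->
  cvgC (fun n => \sum_(0 <= i < n) phi (u i).1 (u i).2) (pairing phi u) /\
  cabs (pairing phi u) <= 2 * limn (series (wt u)).
Proof.
move=> [_ [_ [_ phi1]]] [zu cu]; apply: cvgC_csum => // i.
by apply: phi1; have [] := zu i.
Qed.

(** A [sup] is an upper bound only for a set that is bounded above. The summable weights of the two
    tensors provide such a bound, uniformly over the dual unit ball. *)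
Lemma tdist_ge phi u v : bilin_form1 mu phi -> valid_tensor mu u -> valid_tensor mu v ->
  cabs (pairing phi u - pairing phi v) <= tdist mu u v.
Proof.
move=> bphi vu vv; apply: ub_le_sup; last by exists phi.
exists (2 * limn (series (wt u)) + 2 * limn (series (wt v))) => _ [psi [bpsi ->]].
have [_ h1] := pairing_cvg bpsi vu; have [_ h2] := pairing_cvg bpsi vv.
apply: (le_trans (cabsB _ _)); exact: lerD h1 h2.
Qed.

Lemma valid_le u v (C : R) : 0 <= C -> valid_tensor mu u ->
  (forall i, ZL1 mu (v i).1 /\ ZL1 mu (v i).2) ->
  (forall i, wt v i <= C * wt u i) -> valid_tensor mu v.
Proof.
move=> C0 [zu cu] zv le; split; first exact: zv.
have w0 t i : 0 <= wt t i by rewrite mulr_ge0// nrm1_ge0.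
apply: (series_le_cvg (v_ := C *: wt u)) => [i|i|i|].
- exact: w0.
- by rewrite /= mulr_ge0// w0.
- exact: le.
- exact: is_cvg_seriesZ.
Qed.

Lemma valid_lact a u : pclass a -> valid_tensor mu u -> valid_tensor mu (lact mu a u).
Proof.
move=> ca vu; have la := (pclass_ZL1 haar ca).1.
apply: (valid_le (nrm1_ge0 mu a) vu) => i; have [z1 z2] := vu.1 i.
  by split => //; exact: ZL1_conv_l.
rewrite /wt /= mulrA ler_wpM2r ?nrm1_ge0//; exact: (nrm1_conv haar la z1.1).
Qed.

Lemma valid_ract a u : pclass a -> valid_tensor mu u -> valid_tensor mu (ract mu u a).
Proof.
move=> ca vu; have la := (pclass_ZL1 haar ca).1.
apply: (valid_le (nrm1_ge0 mu a) vu) => i; have [z1 z2] := vu.1 i.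
  by split => //; exact: ZL1_conv_r.
rewrite /wt /= mulrCA ler_wpM2l ?nrm1_ge0// [leRHS]mulrC.
exact: (nrm1_conv haar z2.1 la).
Qed.

Lemma nrm1_0 : nrm1 mu (fun=> 0) = 0.
Proof. by rewrite /nrm1; under eq_Rintegral do rewrite cabs0; rewrite Rintegral_cst// mul0r. Qed.

Lemma valid_tzero u : valid_tensor mu u -> valid_tensor mu (tzero R).
Proof.
move=> vu; have z0 : ZL1 mu (fun=> 0 : complex R).
  by apply: (class_ZL1 haar) => //; exact: (L1_0 haar).
apply: (valid_le (lexx 0) vu) => // i.
by rewrite /wt /= nrm1_0 mul0r mul0r.
Qed.

Definition dual_pair k l a b := cint mu (fun x => a x * k x) * cint mu (fun x => b x * l x).

Lemma dual_pair_bilin k l : pol k -> pol l ->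
  (forall x, SU2 x -> cabs (k x) <= 1) -> (forall x, SU2 x -> cabs (l x) <= 1) ->
  bilin_form1 mu (dual_pair k l).
Proof.
move=> pk pl k1 l1.
have D f g m : pol m -> ZL1 mu f -> ZL1 mu g ->
    cint mu (fun x => (f x + g x) * m x) =
    cint mu (fun x => f x * m x) + cint mu (fun x => g x * m x).
  move=> pm zf zg; under eq_fun do rewrite mulrDl.
  by apply: cintD; [exact: (L1_pol haar zf.1 pm)|exact: (L1_pol haar zg.1 pm)].
have Z c f m : pol m -> ZL1 mu f ->
    cint mu (fun x => (c * f x) * m x) = c * cint mu (fun x => f x * m x).
  move=> pm zf; under eq_fun do rewrite -mulrA.
  by apply: cintZ; exact: (L1_pol haar zf.1 pm).
split; [|split; [|split]] => [a a' b za za' zb|a b b' za zb zb'|c a b za zb|a b za zb];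
  rewrite /dual_pair.
- by rewrite D// mulrDl.
- by rewrite D// mulrDr.
- by rewrite !Z// -mulrA mulrCA.
- rewrite cabsM ler_pM ?cabs_ge0//.
  + by rewrite -[leRHS]mul1r; apply: (cint_mul_le haar za.1 (pol_bdd pk)).
  + by rewrite -[leRHS]mul1r; apply: (cint_mul_le haar zb.1 (pol_bdd pl)).
Qed.

Lemma pol_alphaX n : pol (fun x : X => alpha x ^+ n).
Proof. exact: (polX n (pol_alpha R)). Qed.
Lemma cabs_alphaX n (x : X) : SU2 x -> cabs (alpha x ^+ n) <= 1.
Proof. by move=> sx; rewrite cabsX exprn_ile1 ?cabs_ge0// cabs_alpha. Qed.

Definition om2 m n a b := omega mu m a * omega mu n b.

Lemma om2_bilin m n : bilin_form1 mu (om2 m n).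
Proof.
exact: (dual_pair_bilin (pol_alphaX m) (pol_alphaX n) (@cabs_alphaX m) (@cabs_alphaX n)).
Qed.

Lemma pairing_eq phi psi c u v : bilin_form1 mu phi -> bilin_form1 mu psi ->
  valid_tensor mu u -> valid_tensor mu v ->
  (forall i, phi (u i).1 (u i).2 = c * psi (v i).1 (v i).2) ->
  pairing phi u = c * pairing psi v.
Proof.
move=> bphi bpsi vu vv e; have [h1 _] := pairing_cvg bphi vu.
have [/(cvgCZ c) h2 _] := pairing_cvg bpsi vv; apply: (cvgC_unique h1).
suff -> : (fun n => \sum_(0 <= i < n) phi (u i).1 (u i).2) =
  (fun n => c * \sum_(0 <= i < n) psi (v i).1 (v i).2) by [].
by apply/funext => n; rewrite mulr_sumr; apply: eq_bigr.
Qed.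

(** Multiplicativity takes the scalars [omega m a] and [omega n a] out of the left and right actions
    of [a]. The left side is then the value of one form of the dual unit ball on the commutator. *)
Lemma off_diagonal_le m n a u : pclass a -> valid_tensor mu u ->
  cabs (omega mu m a - omega mu n a) * cabs (pairing (om2 m n) u) <=
  tdist mu (lact mu a u) (ract mu u a).
Proof.
move=> ca vu; have bo := om2_bilin m n.
have za := pclass_ZL1 haar ca.
have [vl vr] := conj (valid_lact ca vu) (valid_ract ca vu).
rewrite -cabsM mulrBl.
rewrite -(pairing_eq (c := omega mu m a) bo bo vl vu); last first.
  move=> i; have [z1 z2] := vu.1 i; rewrite /om2 /= mulrA (omega_conv haar m za.1)//.
  exact: (central_cinv haar z1).
rewrite -(pairing_eq (c := omega mu n a) bo bo vr vu); first exact: tdist_ge.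
move=> i; have [z1 z2] := vu.1 i; rewrite /om2 /= mulrCA (omega_conv haar n z2.1).
  by rewrite (mulrC (omega mu n a)).
exact: (central_cinv haar za).
Qed.

Lemma convDl (f g a : fn) (x : X) : L1 mu f -> L1 mu g -> pclass a -> SU2 x ->
  conv mu (fun y => f y + g y) a x = conv mu f a x + conv mu g a x.
Proof.
move=> lf lg [pa _] sx; rewrite /conv -cintD.
- by congr cint; apply/funext => y; rewrite mulrDl.
- exact: (L1_pol haar lf (pol_invG (pol_mulGr x pa))).
- exact: (L1_pol haar lg (pol_invG (pol_mulGr x pa))).
Qed.

Lemma L1_mpart u n : valid_tensor mu u -> L1 mu (mpart mu u n).
Proof.
move=> [zu _]; apply: (L1_sum haar (F := fun i => conv mu (u i).1 (u i).2)) => i.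
by have [z1 z2] := zu i; exact: (L1_conv haar z1.1 z2.1).
Qed.

Lemma omega_mpart u n m : valid_tensor mu u ->
  omega mu m (mpart mu u n) = \sum_(0 <= i < n) om2 m m (u i).1 (u i).2.
Proof.
move=> [zu _]; rewrite /omega /mpart; under eq_fun do rewrite mulr_suml.
rewrite (cint_sum haar (F := fun i x => conv mu (u i).1 (u i).2 x * alpha x ^+ m)).
  rewrite big_mkord; apply: eq_bigr => i _; have [z1 z2] := zu i.
  exact: (omega_conv haar m z1.1 (central_cinv haar z2)).
move=> i; have [z1 z2] := zu i; apply: (L1_pol haar _ (pol_alphaX m)).
exact: (L1_conv haar z1.1 z2.1).
Qed.

Lemma nrm1_dist (f g : fn) : L1 mu f -> L1 mu g ->
  `|nrm1 mu f - nrm1 mu g| <= nrm1 mu (fun x => f x - g x).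
Proof.
move=> lf lg; have lfg := L1B haar lf lg.
have h1 := nrm1D lfg lg; have h2 := nrm1D lfg lf.
have e1 : (fun x => f x - g x + g x) = f by apply/funext => x; rewrite subrK.
rewrite e1 in h1.
have lgf := L1B haar lg lf; have h3 := nrm1D lgf lf.
have e3 : (fun x => g x - f x + f x) = g by apply/funext => x; rewrite subrK.
rewrite e3 in h3.
have e4 : nrm1 mu (fun x => g x - f x) = nrm1 mu (fun x => f x - g x).
  by congr Rintegral; apply/funext => x; rewrite -cabsN opprB.
by rewrite ler_norml; lra.
Qed.

(** [limn] is informative only along a convergent sequence. Successive terms differ by at most the
    norm of [a] times [wt u i], a summable bound. *)
Lemma cvg_left_err a u : pclass a -> valid_tensor mu u ->
  cvgn (fun n => nrm1 mu (fun x => conv mu (mpart mu u n) a x - a x)).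
Proof.
move=> ca vu; have la := (pclass_ZL1 haar ca).1.
set x := (x in cvgn x).
have lg n : L1 mu (fun x => conv mu (mpart mu u n) a x - a x).
  by apply: (L1B haar) => //; exact: (L1_conv haar (L1_mpart n vu) la).
have step i : `|telescope x i| <= (nrm1 mu a *: wt u) i.
  have [z1 z2] := vu.1 i; have lc := L1_conv haar z1.1 z2.1.
  rewrite /telescope /x; apply: (le_trans (nrm1_dist (lg _) (lg _))).
  apply: (@le_trans _ _ (nrm1 mu (conv mu (conv mu (u i).1 (u i).2) a))).
    apply: (le_nrm1 haar); first exact: (L1B haar).
      exact: (L1_conv haar lc la).
    move=> y sy; rewrite opprB addrA subrK.
    have -> : mpart mu u i.+1 = (fun x => mpart mu u i x + conv mu (u i).1 (u i).2 x).
      by apply/funext => t; rewrite /mpart big_ord_recr.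
    rewrite convDl//; last exact: L1_mpart.
    by rewrite (addrC (_ + _)) addKr.
  apply: (le_trans (nrm1_conv haar lc la)).
  rewrite [leLHS]mulrC; apply: ler_wpM2l; first exact: nrm1_ge0.
  exact: (nrm1_conv haar z1.1 z2.1).
have ct : cvgn (series (telescope x)).
  apply: normed_cvg; apply: (series_le_cvg _ _ step) => [i|i|].
  - by [].
  - exact: le_trans (step i).
  - exact: is_cvg_seriesZ vu.2.
have -> : x = (fun n => x 0%N + series (telescope x) n).
  by apply/funext => n; rewrite -eq_sum_telescope.
by apply: is_cvgD => //; exact: is_cvg_cst.
Qed.

(** The character [omega n] is applied to [m(u) a - a]: multiplicativity factors out [omega n a],
    and the bound by the norm passes to the limit over partial sums. *)
Lemma diagonal_le n a u : pclass a -> valid_tensor mu u ->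
  cabs (omega mu n a) * cabs (pairing (om2 n n) u - 1) <= 2 * m_left_err mu u a.
Proof.
move=> ca vu; have za := pclass_ZL1 haar ca; have la := za.1.
have [h _] := pairing_cvg (om2_bilin n n) vu.
have {}h := cvgCZ (omega mu n a) (cvgCB h (cvgC_cst 1)).
rewrite -cabsM; apply: (cvgC_le h) (cvg_left_err ca vu) => j.
have lm := L1_mpart j vu; have lc := L1_conv haar lm la.
rewrite -omega_mpart//.
have -> : omega mu n a * (omega mu n (mpart mu u j) - 1) =
    omega mu n (fun x => conv mu (mpart mu u j) a x - a x).
  rewrite mulrBr mulr1 mulrC -(omega_conv haar n lm (central_cinv haar za)).
  rewrite -(cintB haar (L1_pol haar lc (pol_alphaX n)) (L1_pol haar la (pol_alphaX n))).
  by congr cint; apply/funext => x; rewrite mulrBl.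
exact: (omega_le haar n (L1B haar lc la)).
Qed.

(** By [cint_chebT], twice the Chebyshev functional is [(n+3) omega (n+2) - (n+1) omega n]; the
    tensor square of this, evaluated at [u], is the expression on the left, whence the constant
    4. *)
Lemma tnorm_cheb_le n u : valid_tensor mu u ->
  cabs (n.+3%:R ^+ 2 * pairing (om2 n.+2 n.+2) u + n.+1%:R ^+ 2 * pairing (om2 n n) u
        - n.+3%:R * n.+1%:R * (pairing (om2 n.+2 n) u + pairing (om2 n n.+2) u))
  <= 4 * tnorm mu u.
Proof.
move=> vu; pose k (x : X) := (cheb n.+2 (trG x)).1.
have [pk _] := pol_cheb n.+2 (@pol_trG R).
have bd := dual_pair_bilin pk pk (@cabs_chebT R n.+2) (@cabs_chebT R n.+2).
have [h _] := pairing_cvg bd vu.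
have v0 := valid_tzero vu.
have pz : pairing (dual_pair k k) (tzero R) = 0.
  rewrite -[RHS](mul0r (pairing (dual_pair k k) u)); apply: (pairing_eq bd bd v0 vu) => i.
  rewrite mul0r /dual_pair /=.
  by under eq_fun do rewrite mul0r; rewrite cint0 ?mul0r.
have := tdist_ge bd vu v0; rewrite -/k pz subr0 -/(tnorm mu u) => t.
have h' := And4 (pairing_cvg (om2_bilin n.+2 n.+2) vu).1 (pairing_cvg (om2_bilin n n) vu).1
  (pairing_cvg (om2_bilin n.+2 n) vu).1 (pairing_cvg (om2_bilin n n.+2) vu).1.
have [h1 h2 h3 h4] := h'.
have hc := cvgCB (cvgCD (cvgCZ (n.+3%:R ^+ 2) h1) (cvgCZ (n.+1%:R ^+ 2) h2))
  (cvgCZ (n.+3%:R * n.+1%:R) (cvgCD h3 h4)).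
suff -> : n.+3%:R ^+ 2 * pairing (om2 n.+2 n.+2) u + n.+1%:R ^+ 2 * pairing (om2 n n) u
    - n.+3%:R * n.+1%:R * (pairing (om2 n.+2 n) u + pairing (om2 n n.+2) u) =
    4%:R * pairing (dual_pair k k) u.
  by rewrite cabsM cabs_nat ler_pM2l.
apply: (cvgC_unique hc); have {}h := cvgCZ 4%:R h.
suff e : (fun j => 4%:R * \sum_(0 <= i < j) dual_pair k k (u i).1 (u i).2) =
  (fun j => n.+3%:R ^+ 2 * (\sum_(0 <= i < j) om2 n.+2 n.+2 (u i).1 (u i).2) +
   n.+1%:R ^+ 2 * (\sum_(0 <= i < j) om2 n n (u i).1 (u i).2) -
   n.+3%:R * n.+1%:R * ((\sum_(0 <= i < j) om2 n.+2 n (u i).1 (u i).2) +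
                        (\sum_(0 <= i < j) om2 n n.+2 (u i).1 (u i).2))) by rewrite -e.
apply/funext => j; rewrite -big_split/= !mulr_sumr -big_split/= -sumrB.
apply: eq_bigr => i _; have [z1 z2] := vu.1 i.
have e1 := cint_chebT haar n (central_cinv haar z1).
have e2 := cint_chebT haar n (central_cinv haar z2).
have -> : 4%:R * dual_pair k k (u i).1 (u i).2 =
    (2%:R * cint mu (fun x => (u i).1 x * k x)) * (2%:R * cint mu (fun x => (u i).2 x * k x)).
  by rewrite /dual_pair; ring.
by rewrite e1 e2 /om2; ring.
Qed.

End Tensors.

(** * Limits along a net and the final contradiction *)

Section Nets.
Context {R : realType} {I : Type} (le : I -> I -> Prop).
Hypothesis dir : directed_set le.

Definition ev (P : I -> Prop) := exists i0, forall i, le i0 i -> P i.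

Lemma ev_and P Q : ev P -> ev Q -> ev (fun i => P i /\ Q i).
Proof.
move=> [i Pi] [j Qj]; have [_ [_ [tr ub]]] := dir; have [k [ik jk]] := ub i j.
by exists k => t kt; split; [apply: Pi; exact: tr kt|apply: Qj; exact: tr kt].
Qed.

Lemma ev_ex P : ev P -> exists i, P i.
Proof. by move=> [i Pi]; exists i; apply: Pi; have [_ [rf _]] := dir. Qed.

Lemma ev_small (r y : I -> R) (c d : R) : net_to0 le r -> 0 < c -> 0 < d ->
  (forall i, c * y i <= 2 * r i) -> ev (fun i => y i < d).
Proof.
move=> r0 c0 d0 h; have [i0 hi0] := r0 (c * d / 2) ltac:(by rewrite divr_gt0// mulr_gt0).
exists i0 => i /hi0 ri; rewrite -(ltr_pM2l c0).
apply: (le_lt_trans (h i)); have := ler_norm (r i); lra.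
Qed.

End Nets.

(** Replacing the four pairings by their limits 1, 1, 0, 0 costs at most [d] times the sum of the
    absolute values of the coefficients, which is [(N + M) ^ 2]. *)
Lemma near_diagonal_le (R : realType) (N M d K : R) (P1 P2 P3 P4 : complex R) :
  0 <= N -> 0 <= M -> cabs (P1 - 1) <= d -> cabs (P2 - 1) <= d ->
  cabs P3 <= d -> cabs P4 <= d ->
  cabs (N%:C%C ^+ 2 * P2 + M%:C%C ^+ 2 * P1 - N%:C%C * M%:C%C * (P4 + P3)) <= K ->
  N ^+ 2 + M ^+ 2 <= K + d * (N + M) ^+ 2.
Proof.
move=> N0 M0 h1 h2 h3 h4 hK.
have -> : N ^+ 2 + M ^+ 2 = cabs (N%:C%C ^+ 2 + M%:C%C ^+ 2 : complex R).
  by rewrite -!rmorphXn -rmorphD cabs_real ger0_norm// addr_ge0// sqr_ge0.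
have -> : N%:C%C ^+ 2 + M%:C%C ^+ 2 =
  (N%:C%C ^+ 2 * P2 + M%:C%C ^+ 2 * P1 - N%:C%C * M%:C%C * (P4 + P3)) +
  (N%:C%C * M%:C%C * (P4 + P3) - (N%:C%C ^+ 2 * (P2 - 1) + M%:C%C ^+ 2 * (P1 - 1))) by ring.
apply: (le_trans (cabsD _ _)); apply: lerD => //.
apply: (le_trans (cabsB _ _)).
have -> : d * (N + M) ^+ 2 = N * M * (d + d) + (N ^+ 2 * d + M ^+ 2 * d) by ring.
apply: lerD.
  rewrite !cabsM !cabs_real !ger0_norm// ler_wpM2l ?mulr_ge0//.
  by rewrite (le_trans (cabsD _ _))// lerD.
apply: (le_trans (cabsD _ _)); apply: lerD;
  by rewrite cabsM cabsX cabs_real ger0_norm// ler_wpM2l// sqr_ge0.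
Qed.

Theorem theorem1p12 (R : realType) (mu : probability (SU2car R) R) :
  is_haar mu -> ~ ZL1_amenable mu.
Proof.
move=> haar [I [le [net [dir [vn [[K netK] app]]]]]].
(* The final inequality is [(n+3)^2 + (n+1)^2 <= 4 * K + 1], which fails for any [n] above
   [4 * K]. *)
have [n nK] : exists n : nat, 4 * K < n%:R.
  exists (Num.bound (4 * `|K|)); apply: (le_lt_trans _ (archi_boundP _)); last by rewrite mulr_ge0.
  by rewrite ler_wpM2l// ler_norm.
(* [trG ^ n] is annihilated by [omega n.+2] but not by [omega n], so it settles both off-diagonal
   pairings and one diagonal pairing; [trG ^ n.+2] settles the other. *)
have [cn cN] := conj (@pclass_trX R n) (@pclass_trX R n.+2).
have [zn zN] := conj (pclass_ZL1 haar cn) (pclass_ZL1 haar cN).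
have pos (z : complex R) : z <> 0 -> 0 < cabs z.
  move=> z0; rewrite lt_neqAle cabs_ge0 andbT eq_sym; apply/eqP => /cabs_eq0; exact: z0.
pose c1 := omega mu n (fun x => trG x ^+ n).
pose c2 := omega mu n.+2 (fun x => trG x ^+ n.+2).
have c1p : 0 < cabs c1 := pos _ (@omega_trX_neq0 _ _ haar n).
have c2p : 0 < cabs c2 := pos _ (@omega_trX_neq0 _ _ haar n.+2).
have c0 : omega mu n.+2 (fun x => trG x ^+ n) = 0 by apply: omega_trX_small.
have [l1 [_ t1]] := app _ zn; have [l2 _] := app _ zN.
(* The tolerance that makes the total error in [near_diagonal_le] equal to 1. *)
pose d : R := (((n.+3%:R + n.+1%:R) ^+ 2))^-1.
have s0 : 0 < ((n.+3%:R + n.+1%:R) ^+ 2 : R) by rewrite exprn_gt0// addr_gt0.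
have d0 : 0 < d by rewrite invr_gt0.
(* [ev_small] expects a bound by [2 * r] and [off_diagonal_le] gives [r]; nonnegativity of [r]
   bridges the two. *)
have tp i : 0 <= tdist mu (lact mu (fun x => trG x ^+ n) (net i)) (ract mu (net i) (fun x => trG x ^+ n)).
  apply: le_trans (off_diagonal_le haar n n cn (vn i)).
  by rewrite mulr_ge0 ?cabs_ge0.
have o1 := ev_small t1 c1p d0 (y := fun i => cabs (pairing (om2 mu n n.+2) (net i))).
have o2 := ev_small t1 c1p d0 (y := fun i => cabs (pairing (om2 mu n.+2 n) (net i))).
have e1 := ev_small l1 c1p d0 (fun i => diagonal_le haar n cn (vn i)).
have e2 := ev_small l2 c2p d0 (fun i => diagonal_le haar n.+2 cN (vn i)).
have {}o1 : ev le (fun i => cabs (pairing (om2 mu n n.+2) (net i)) < d).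
  apply: o1 => i; have := off_diagonal_le haar n n.+2 cn (vn i).
  by rewrite c0 subr0 -/c1; have := tp i; lra.
have {}o2 : ev le (fun i => cabs (pairing (om2 mu n.+2 n) (net i)) < d).
  apply: o2 => i; have := off_diagonal_le haar n.+2 n cn (vn i).
  by rewrite c0 sub0r cabsN -/c1; have := tp i; lra.
have [i [[h1 h2] [h3 h4]]] := ev_ex dir (ev_and dir (ev_and dir e1 e2) (ev_and dir o1 o2)).
have := le_trans (tnorm_cheb_le haar n (vn i)) (ler_wpM2l (ler0n R 4) (netK i)).
move: h1 h2 h3 h4; set P1 := pairing _ _; set P2 := pairing _ _.
set P3 := pairing _ _; set P4 := pairing _ _ => h1 h2 h3 h4 hK.
rewrite -!(rmorph_nat (real_complex R)) in hK.
have := near_diagonal_le (ler0n R n.+3) (ler0n R n.+1) (ltW h1) (ltW h2) (ltW h3) (ltW h4) hK.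
rewrite mulVf ?gt_eqF//.
have -> : n.+3%:R = n%:R + 3%:R :> R by rewrite -natrD addn3.
have -> : n.+1%:R = n%:R + 1 :> R by rewrite -natr1.
by have := ler0n R n; nra.
Qed.
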